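(* Let $N$ be an $n$-dimensional Riemannian manifold, let $f\colon \mathbb{R}\to\mathbb{R}_{>0}$ be a smooth logarithmically convex function, and let $W=\mathbb{R}\times_f N$ be the associated $(1+n)$-dimensional warped product, assumed complete. Let $b\in\mathbb{R}$, let $F\subseteq\{b\}\times N\subset W$ be a piecewise smooth $k$-dimensional subset of finite $k$-volume, and let $g\colon\eta(F)\to[b,\infty)$ be a (possibly discontinuous) map that is differentiable almost everywhere. Let $C$ be the graph of $g$ over $F$ and let $R$ be the room enclosed by $C$ over $F$. Let $S$ be the constant height graph over $F$ (on the same side of $F$ as $C$) whose associated room has the same $(1+k)$-dimensional volume as $R$. Then $$\mathrm{Vol}_k(S)\le \mathrm{Vol}_k(C),$$ with equality if and only if $g$ is a piecewise constant map and either $C=S$ (up to measure zero) or $f$ is not strictly log convex on a set of positive measure.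
   Context: Warped product: given a smooth function $f\colon\mathbb{R}\to\mathbb{R}_{>0}$ and a Riemannian manifold $N$, let $\pi\colon\mathbb{R}\times N\to\mathbb{R}$ and $\eta\colon\mathbb{R}\times N\to N$ be the projections. The warped product $W=\mathbb{R}\times_f N$ is the product manifold $\mathbb{R}\times N$ with the Riemannian metric satisfying $\|v\|_W^2=\|\pi_*(v)\|_{\mathbb{R}}^2+f(\pi(p))^2\|\eta_*(v)\|_N^2$ for all $v\in T_pW$. The function $f$ is logarithmically convex if $\log f$ is convex. The set $\{b\}\times N$ is called a vertical fiber. Graphs and rooms: for $F\subseteq\{b\}\times N$ and $g\colon\eta(F)\to[b,\infty)$, the graph of $g$ over $F$ (the ceiling) is $C=\{(g(q),q): (b,q)\in F\}\subset W$, and the room enclosed by $C$ over $F$ (the floor) is $R=\{(t,q): (b,q)\in F,\ b\le t\le g(q)\}\subset W$. A constant height graph over $F$, on the same side of $F$ as $C$, is the graph over $F$ of a constant function $q\mapsto b+H$ with $H\ge 0$. $\mathrm{Vol}_k(\cdot)$ denotes $k$-dimensional volume with respect to the metric of $W$; if $F$ is $k$-dimensional, then the ceiling $C$ has $k$-dimensional volume and the room $R$ has $(1+k)$-dimensional volume.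
   Formalization: Takes k ≥ 1 and volume as the area integral; ''piecewise constant'' means dg = 0 a.e. (locally constant where g is C^1); ''f not strictly log convex on a set of positive measure'' means: nowhere strictly log convex on a nondegenerate interval containing almost all heights of C. *)

(* Defs.v *)
From HB Require Import structures.
From mathcomp Require Import all_boot all_order all_algebra.
From mathcomp Require Import all_classical all_reals all_analysis.

Set Implicit Arguments.
Unset Strict Implicit.
Unset Printing Implicit Defensive.

Import Order.TTheory GRing.Theory Num.Theory.
Import numFieldNormedType.Exports.

Local Open Scope classical_set_scope.
Local Open Scope ring_scope.

Definition rV_display : measure_display.
Proof. exact: (measure_tuple_display default_measure_display). Qed.

Section measurable_rV.
Context (R : realType) (k : nat).

(* The sigma-algebra generated by the coordinates, i.e. the Borel sets. *)
Let coord (i : 'I_k) (x : 'rV[R]_k) : measurableTypeR R := x ord0 i.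

Let rV_set0 : g_sigma_preimage coord set0.
Proof. exact: sigma_algebra0. Qed.

Let rV_setC A : g_sigma_preimage coord A -> g_sigma_preimage coord (~` A).
Proof. exact: sigma_algebraC. Qed.

Let rV_bigcup (F : (set 'rV[R]_k)^nat) :
  (forall i, g_sigma_preimage coord (F i)) ->
  g_sigma_preimage coord (\bigcup_i F i).
Proof. exact: sigma_algebra_bigcup. Qed.

HB.instance Definition _ := @isMeasurable.Build rV_display
  'rV[R]_k (g_sigma_preimage coord) rV_set0 rV_setC rV_bigcup.

Lemma measurable_rV_coord (i : 'I_k) :
  measurable_fun setT (fun x : 'rV[R]_k => x ord0 i : measurableTypeR R).
Proof.
move=> _ Y mY; rewrite setTI; apply: sub_sigma_algebra.
by rewrite (bigD1 i)//=; left; exists Y => //; rewrite setTI.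
Qed.

Lemma measurable_to_rV d (T : measurableType d) (h : T -> 'rV[R]_k) :
  (forall i, measurable_fun setT (fun t => h t ord0 i : measurableTypeR R)) ->
  measurable_fun setT h.
Proof.
move=> mh; apply: (@measurability _ _ _ _ _ _
  (\big[setU/set0]_(i < k) preimage_set_system setT (coord i) measurable)) => //.
move=> _ [B + <-]; elim/big_ind: _ => [[]|A C hA hC [/hA|/hC]//|i _ [Y mY <-]].
by rewrite !setTI; have := mh i measurableT Y mY; rewrite setTI.
Qed.

End measurable_rV.

Section lebesgue_rV.
Context (R : realType).

Definition consrV k (p : measurableTypeR R * 'rV[R]_k) : 'rV[R]_(1 + k) :=
  row_mx (p.1)%:M p.2.

Lemma measurable_consrV k : measurable_fun setT (@consrV k).
Proof.
apply: measurable_to_rV => i; case: (split_ordP i) => j ->.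
  rewrite (_ : (fun t => _) = fst); first exact: measurable_fst.
  by apply/funext => t; rewrite /consrV row_mxEl [j]ord1 mxE.
rewrite (_ : (fun t => _) = (fun x : 'rV_k => x ord0 j : measurableTypeR R) \o snd).
  by apply: measurableT_comp; [exact: measurable_rV_coord|exact: measurable_snd].
by apply/funext => t; rewrite /consrV row_mxEr.
Qed.

Section step.
Context (k : nat) (mu : {sigma_finite_measure set 'rV[R]_k -> \bar R}).

Definition lebesgue_rV_step : set 'rV[R]_(1 + k) -> \bar R :=
  pushforward (@lebesgue_measure R \x mu)%E (@consrV k).

Let step0 : lebesgue_rV_step set0 = 0%E.
Proof. by rewrite /lebesgue_rV_step /pushforward preimage_set0 measure0. Qed.

Let mpre A : measurable A -> measurable (@consrV k @^-1` A).
Proof. by move=> mA; rewrite -[X in measurable X]setTI; exact: measurable_consrV. Qed.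

Let step_ge0 A : (0 <= lebesgue_rV_step A)%E.
Proof. by rewrite /lebesgue_rV_step /pushforward; exact: measure_ge0. Qed.

Let step_sigma_additive : semi_sigma_additive lebesgue_rV_step.
Proof.
move=> F mF tF mUF; rewrite /lebesgue_rV_step /pushforward preimage_bigcup.
apply: measure_semi_sigma_additive => [n||]; first exact: mpre.
- apply/trivIsetP => /= i j _ _ ij; rewrite -preimage_setI.
  by move/trivIsetP : tF => /(_ _ _ _ _ ij) ->//; rewrite preimage_set0.
- by rewrite -preimage_bigcup; exact: mpre.
Qed.

HB.instance Definition _ := isMeasure.Build _ _ _ lebesgue_rV_step
  step0 step_ge0 step_sigma_additive.

Let step_sigma_finite : sigma_finite setT lebesgue_rV_step.
Proof.
have /sigma_finiteP[F [TF ndF Foo]] := sigma_finiteT (@lebesgue_measure R).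
have /sigma_finiteP[G [TG ndG Goo]] := sigma_finiteT mu.
pose split_rV (x : 'rV[R]_(1 + k)) : measurableTypeR R * 'rV[R]_k :=
  (lsubmx x ord0 ord0, rsubmx x).
have msplit : measurable_fun setT split_rV.
  apply/measurable_fun_pairP; split.
    rewrite (_ : _ \o _ = fun x : 'rV[R]_(1 + k) => x ord0 (lshift k ord0) : measurableTypeR R).
      exact: measurable_rV_coord.
    by apply/funext => x /=; rewrite mxE.
  apply: measurable_to_rV => i.
  rewrite (_ : (fun t => _) = fun x : 'rV[R]_(1 + k) => x ord0 (rshift 1 i) : measurableTypeR R).
    exact: measurable_rV_coord.
  by apply/funext => x /=; rewrite mxE.
have splitK : cancel (@consrV k) split_rV.
  by move=> [t x]; rewrite /split_rV /consrV row_mxKl row_mxKr mxE eqxx mulr1n.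
exists (fun i => split_rV @^-1` (F i `*` G i)).
  apply/esym; rewrite -subTset => x _.
  have [i _ Fi] : (\bigcup_i F i) (split_rV x).1 by rewrite -TF.
  have [j _ Gj] : (\bigcup_i G i) (split_rV x).2 by rewrite -TG.
  exists (maxn i j) => //; split.
    by move: Fi; exact/subsetPset/ndF/leq_maxl.
  by move: Gj; exact/subsetPset/ndG/leq_maxr.
move=> i; have [mF Fy] := Foo i; have [mG Gy] := Goo i; split.
  by rewrite -[X in measurable X]setTI; apply: msplit => //; exact: measurableX.
rewrite /lebesgue_rV_step /pushforward -comp_preimage.
rewrite (_ : split_rV \o _ = id) ?funeqE// preimage_id product_measure1E//.
by rewrite lte_mul_pinfty// ge0_fin_numE.
Qed.

HB.instance Definition _ := Measure_isSigmaFinite.Build _ _ _ lebesgue_rV_step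
  step_sigma_finite.

End step.

(* R^0 is a point, of mass 1, and Lebesgue measure on R^(1 + k) is the product
   of those on R and on R^k. *)
Fixpoint lebesgue_rV k : {sigma_finite_measure set 'rV[R]_k -> \bar R} :=
  if k is k'.+1 then lebesgue_rV_step (lebesgue_rV k') else \d_(0 : 'rV[R]_0).

End lebesgue_rV.

Section smooth.
Context (R : realType) (V W : normedModType R).

(* For open [U]: all iterated directional derivatives up to order [m] exist, by
   differentiability, and are continuous on [U]. *)
Fixpoint Ck_on (m : nat) (U : set V) (h : V -> W) : Prop :=
  if m is m'.+1 then
    (forall x, U x -> differentiable h x) /\
    (forall v, Ck_on m' U (fun x => 'D_v h x))
  else forall x, U x -> {for x, continuous h}.

Definition smooth_on (U : set V) (h : V -> W) := forall m, Ck_on m U h.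

End smooth.

Definition strictly_convex_on (R : realType) (J : set R) (u : R -> R) :=
  forall x y s, J x -> J y -> x != y -> 0 < s < 1 ->
    u (s * x + (1 - s) * y) < s * u x + (1 - s) * u y.

(* The charts are total functions, meaningful on [chart_dom] and on its image;
   [metric i] is the matrix of the metric in the chart [i]. Tangent vectors are
   row vectors, so that [v] has squared length [v *m metric i x *m v^T]. *)
Record riemannian (R : realType) (n : nat) := Riemannian {
  points :> topologicalType;
  chart_index : Type;
  chart_dom : chart_index -> set points;
  chart : chart_index -> points -> 'rV[R]_n;
  chart_inv : chart_index -> 'rV[R]_n -> points;
  chart_at : points -> chart_index;
  metric : chart_index -> 'rV[R]_n -> 'M[R]_n }.

Arguments chart_dom {R n r} _.
Arguments chart {R n r} _ _.
Arguments chart_inv {R n r} _ _.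
Arguments chart_at {R n r} _.
Arguments metric {R n r} _ _.

Record is_riemannian (R : realType) (n : nat) (M : riemannian R n) : Prop := {
  manifold_hausdorff : hausdorff_space M;
  manifold_countable : @second_countable M;
  chart_dom_open : forall i : chart_index M, open (chart_dom i);
  chart_at_dom : forall p : M, chart_dom (chart_at p) p;
  chart_image_open : forall i : chart_index M, open (chart i @` chart_dom i);
  chartK : forall (i : chart_index M) p, chart_dom i p ->
    chart_inv i (chart i p) = p;
  chart_continuous : forall (i : chart_index M) p, chart_dom i p ->
    {for p, continuous (chart i)};
  chart_inv_continuous : forall (i : chart_index M) p, chart_dom i p ->
    {for chart i p, continuous (chart_inv i)};
  transition_smooth : forall i j : chart_index M,
    smooth_on (chart i @` (chart_dom i `&` chart_dom j))
      (chart j \o chart_inv i);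
  metric_smooth : forall i : chart_index M,
    smooth_on (chart i @` chart_dom i) (metric i);
  metric_sym : forall (i : chart_index M) p, chart_dom i p ->
    (metric i (chart i p))^T = metric i (chart i p);
  metric_pos : forall (i : chart_index M) p (v : 'rV[R]_n), chart_dom i p -> v != 0 ->
    0 < (v *m metric i (chart i p) *m v^T) ord0 ord0;
  metric_change : forall (i j : chart_index M) p,
    chart_dom i p -> chart_dom j p ->
    let J := 'J (chart j \o chart_inv i) (chart i p) in
    metric i (chart i p) = J *m metric j (chart j p) *m J^T }.

Section maps_into_manifold.
Context (R : realType) (n : nat) (M : riemannian R n).

Definition smooth_map k (U : set 'rV[R]_k) (phi : 'rV[R]_k -> M) :=
  (forall x, U x -> {for x, continuous phi}) /\
  (forall i, smooth_on (U `&` phi @^-1` chart_dom i) (chart i \o phi)).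

(* The differential of [phi] at [x], in the preferred chart at [phi x]. *)
Definition mdiff k (phi : 'rV[R]_k -> M) (x : 'rV[R]_k) : 'M[R]_(k, n) :=
  'J (chart (chart_at (phi x)) \o phi) x.

(* The matrix of the pulled back metric; by [metric_change] it does not depend
   on the chart. *)
Definition gram k (phi : 'rV[R]_k -> M) (x : 'rV[R]_k) : 'M[R]_k :=
  let i := chart_at (phi x) in
  mdiff phi x *m metric i (chart i (phi x)) *m (mdiff phi x)^T.

(* The k-volume as the integral of the k-dimensional Jacobian. Where [phi] is not
   differentiable the integrand is a junk value, so [phi] has to be
   differentiable at almost every point of [D]. *)
Definition param_volume k (D : set 'rV[R]_k) (phi : 'rV[R]_k -> M) : \bar R :=
  (\int[lebesgue_rV R k]_(x in D) (Num.sqrt (\det (gram phi x)))%:E)%E.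

(* A smooth curve is parametrized by [0, 1]; its length is its 1-volume. *)
Definition riem_dist (p q : M) : \bar R :=
  ereal_inf [set param_volume [set x : 'rV[R]_1 | 0 <= x ord0 ord0 <= 1] c |
    c in [set c : 'rV[R]_1 -> M |
      [/\ smooth_map setT c, c 0 = p & c (const_mx 1) = q]]].

Definition complete_riemannian :=
  forall u : nat -> M,
    (forall e : R, 0 < e -> exists m0, forall l m,
      (m0 <= l)%N -> (m0 <= m)%N -> (riem_dist (u l) (u m) < e%:E)%E) ->
    exists p : M, u @ \oo --> p.

End maps_into_manifold.

Record patches (R : realType) (n : nat) (M : riemannian R n) (k : nat) :=
  Patches {
    pdom : nat -> set 'rV[R]_k;
    pmap : nat -> 'rV[R]_k -> M }.

Definition pimage (R : realType) (n : nat) (M : riemannian R n) (k : nat)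
    (P : patches M k) : set M := \bigcup_i (pmap P i @` pdom P i).

Section patches.
Context (R : realType) (n : nat) (M : riemannian R n) (k : nat).
Implicit Types (P : patches M k) (A : set M).

Definition volume P : \bar R :=
  (\sum_(0 <= i <oo) param_volume (pdom P i) (pmap P i))%E.

(* [A] is, up to countably many smooth images of lower dimension (the lower
   dimensional strata), the disjoint union of the injectively immersed open
   patches of [P]. *)
Record piecewise_smooth A P : Prop := {
  patch_open : forall i, open (pdom P i);
  patch_smooth : forall i, smooth_map (pdom P i) (pmap P i);
  patch_immersion : forall i x, pdom P i x -> row_free (mdiff (pmap P i) x);
  patch_inj : forall i j x y, pdom P i x -> pdom P j y ->
    pmap P i x = pmap P j y -> i = j /\ x = y;
  patch_sub : pimage P `<=` A;
  patch_rest : exists Q : patches M k.-1,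
    (forall i, open (pdom Q i) /\ smooth_map (pdom Q i) (pmap Q i)) /\
    A `\` pimage P `<=` pimage Q }.

(* The volume densities below are positive, so that the sets of zero k-volume are
   those that are Lebesgue negligible in the parameters. *)
Definition ae_patches P (Q : nat -> 'rV[R]_k -> Prop) :=
  forall i, {ae lebesgue_rV R k, forall x, pdom P i x -> Q i x}.

Definition ae_in P A := ae_patches P (fun i x => A (pmap P i x)).

End patches.

Section warped_product.
Context (R : realType) (n : nat) (f : R -> R) (N : riemannian R n).

Definition warped_product : riemannian R (1 + n) :=
  @Riemannian R (1 + n) (R * N)%type (chart_index N)
    (fun i => setT `*` chart_dom i)
    (fun i p => row_mx (p.1)%:M (chart i p.2))
    (fun i x => (lsubmx x ord0 ord0, chart_inv i (rsubmx x)))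
    (fun p => chart_at p.2)
    (fun i x => block_mx 1%:M 0 0
       (f (lsubmx x ord0 ord0) ^+ 2 *: metric i (rsubmx x))).

Local Notation W := warped_product.

Definition wproj1 (p : W) : R := p.1.
Definition wproj2 (p : W) : N := p.2.
Definition wpair (t : R) (q : N) : W := (t, q).

Definition fiber (b : R) : set W := [set p | wproj1 p = b].

(* The functions on the projection of the floor are taken to be total. *)
Definition ceiling (F : set W) (g : N -> R) : set W :=
  [set wpair (g (wproj2 p)) (wproj2 p) | p in F].

Definition room (F : set W) (b : R) (g : N -> R) : set W :=
  [set r | exists2 p, F p &
    b <= wproj1 r <= g (wproj2 p) /\ wproj2 r = wproj2 p].

Context (k : nat) (P : patches W k).

Definition ceiling_patches (g : N -> R) : patches W k :=
  Patches (pdom P)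
    (fun i x => wpair (g (wproj2 (pmap P i x))) (wproj2 (pmap P i x))).

Definition room_patches (b : R) (g : N -> R) : patches W (1 + k) :=
  Patches
    (fun i => [set z | pdom P i (rsubmx z) /\
       b <= lsubmx z ord0 ord0 <= g (wproj2 (pmap P i (rsubmx z)))])
    (fun i z => wpair (lsubmx z ord0 ord0) (wproj2 (pmap P i (rsubmx z)))).

Lemma pimage_ceiling (g : N -> R) :
  pimage (ceiling_patches g) = ceiling (pimage P) g.
Proof.
apply/seteqP; split => [_ [i _ [x Dx <-]]|_ [_ [i _ [x Dx <-]] <-]].
  by exists (pmap P i x) => //; exists i => //; exists x.
by exists i => //; exists x.
Qed.

Lemma pimage_room (b : R) (g : N -> R) :
  pimage (room_patches b g) = room (pimage P) b g.
Proof.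
apply/seteqP; split => [_ [i _ [z [Dz gz] <-]]|[t q] [_ [i _ [x Dx <-]]]].
  by exists (pmap P i (rsubmx z)) => //; exists i => //; exists (rsubmx z).
rewrite /wproj1 /wproj2 /= => -[gt ->].
exists i => //; exists (row_mx t%:M x); rewrite /= row_mxKl row_mxKr mxE eqxx//.
Qed.

Definition along (g : N -> R) (i : nat) (x : 'rV[R]_k) : R :=
  g (wproj2 (pmap P i x)).

Definition ae_differentiable (g : N -> R) :=
  ae_patches P (fun i x => differentiable (along g i) x).

(* For a function that is only differentiable almost everywhere, being piecewise
   constant can only mean that the differential vanishes almost everywhere: a
   strictly increasing pure jump function is differentiable with derivative 0
   almost everywhere, so that its graph is as small as that of a constant when
   [f] is constant, but it is constant on no two points. On the open pieces
   where [g] is C^1 it is required to be locally constant in the usual sense. *)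
Definition piecewise_constant (g : N -> R) :=
  ae_patches P (fun i x => forall v, 'd (along g i) x v = 0) /\
  (forall i U, open U -> U `<=` pdom P i -> Ck_on 1 U (along g i) ->
    forall x, U x -> \forall y \near x, along g i y = along g i x).

End warped_product.

Definition log_convex (R : realType) (f : R -> R) :=
  convex_function (setT : set R^o) (fun t => ln (f t)).

(* Failure of strict log convexity at every place of [J], not merely somewhere
   in [J]. *)
Definition nowhere_strictly_log_convex (R : realType) (f : R -> R) (J : set R) :=
  forall s t, s < t -> `[s, t] `<=` J ->
    ~ strictly_convex_on `[s, t] (fun r => ln (f r)).

(* Main.v *)
(* In the parameters of a patch let [rho] be the volume density of the projection
   of the floor to [N] and [h] the height of the ceiling. The floor has volume
   [f(b)^k \int rho], the room has volume [\int rho V(h)] with [V' = f^k] and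
   [V(b) = 0], and the ceiling has volume
   [\int sqrt(det(w w^T + f(h)^2 G)) >= \int rho f(h)^k], where [w] is the gradient
   of [h] and [G] the Gram matrix of the projection, with equality iff [w = 0]
   almost everywhere.

   Put [c = b + H], [u = ln f] and calibrate by
   [e(t) = f(t)^k - f(c)^k - k u'(c) (V(t) - V(c))]. Since
   [e' = k (u' - u'(c)) f^k] and [u'] is nondecreasing, [e] decreases before [c] and
   increases after [c], so [e >= 0 = e(c)]. The rooms having equal volumes, the term
   in [V] integrates to zero and
   [\int rho f(h)^k = f(c)^k \int rho + \int rho e(h)],
   which is the inequality. Equality holds iff moreover [e(h) = 0] almost everywhere;
   the zero set of [e] is an interval around [c] on which [u'] is constant.
   Conversely, on an interval where [u] is nowhere strictly convex, the continuous
   function [u''] vanishes, hence so does [e] if the interval contains [c]; and if it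
   does not, then [h] stays on one side of [c], which together with the equality of
   the volumes of the rooms gives [h = c] almost everywhere. *)

Require Import Defs.
From HB Require Import structures.
From mathcomp Require Import all_boot all_order all_algebra.
From mathcomp Require Import all_classical all_reals all_analysis.
From mathcomp Require Import measurable_realfun ring lra.

Set Implicit Arguments.
Unset Strict Implicit.
Unset Printing Implicit Defensive.

Import Order.TTheory GRing.Theory Num.Theory.
Import numFieldNormedType.Exports.

Local Open Scope classical_set_scope.
Local Open Scope ring_scope.

(** * Determinants of positive definite matrices *)

Section posdef.
Context (R : realFieldType).

Definition posdef k (G : 'M[R]_k) :=
  G^T = G /\ forall v : 'rV_k, v != 0 -> 0 < (v *m G *m v^T) ord0 ord0.

Lemma posdef_unitmx k (G : 'M[R]_k) : posdef G -> G \in unitmx.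
Proof.
move=> [_ pG]; rewrite -row_free_unit; apply/row_freeP.
case: (boolP (row_free G)) => [/row_freeP//|]; rewrite -kermx_eq0.
move=> /rowV0Pn[v /sub_kermxP vG v0]; have := pG v v0.
by rewrite vG mul0mx mxE ltxx.
Qed.

Lemma quad_block k (a : 'M[R]_1) (u : 'rV_k) (B : 'M[R]_k) (x : 'M[R]_1) (y : 'rV_k) :
  row_mx x y *m block_mx a u u^T B *m (row_mx x y)^T =
  (x *m a + y *m u^T) *m x^T + (x *m u + y *m B) *m y^T.
Proof. by rewrite mul_row_block tr_row_mx mul_row_col. Qed.

(* Induction on the size, through the Schur complement. *)
Lemma posdef_det_gt0 k (G : 'M[R]_k) : posdef G -> 0 < \det G.
Proof.
elim: k G => [G _|k IH]; first by rewrite det_mx00.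
rewrite -[k.+1]/(1 + k)%N => G.
have [a [u [w [B ->]]]] : exists a u w B, G = block_mx (a : 'M[R]_1) u w (B : 'M[R]_k).
  by exists (ulsubmx G), (ursubmx G), (dlsubmx G), (drsubmx G); rewrite submxK.
move=> [symG pG].
have [ew eB] : w = u^T /\ B^T = B.
  move: symG; rewrite tr_block_mx => /eq_block_mx[_ e _ eB].
  by split => //; rewrite -e trmxK.
rewrite ew in pG *.
have a0 : 0 < a ord0 ord0.
  have := pG (row_mx 1%:M 0).
  rewrite quad_block !mul1mx !mul0mx addr0 trmx0 mulmx0 addr0 trmx1 mulmx1.
  apply; apply/eqP => /(congr1 (fun M : 'rV[R]_(1 + k) => M ord0 (lshift k ord0))).
  by rewrite row_mxEl !mxE/=; apply/eqP; rewrite oner_eq0.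
have ea : a = (a ord0 ord0)%:M by apply/matrixP => i j; rewrite !ord1 mxE eqxx mulr1n.
have ua : a \in unitmx.
  by rewrite ea unitmxE det_scalar expr1 unitfE gt_eqF.
pose S := B - u^T *m invmx a *m u.
have -> : block_mx a u u^T B =
    block_mx 1%:M 0 (u^T *m invmx a) 1%:M *m block_mx a u 0 S.
  rewrite mulmx_block !mul1mx !mul0mx ?mulmx0 !addr0 mulmxKV// .
  by rewrite /S addrC subrK.
rewrite det_mulmx det_lblock !det1 !mul1r det_ublock.
rewrite {1}ea det_scalar expr1 mulr_gt0//.
have ia : (invmx a)^T = invmx a by rewrite trmx_inv ea tr_scalar_mx.
apply: IH; split.
  by rewrite /S linearB/= eB !trmx_mul trmxK ia mulmxA.
(* For fixed [y], this first coordinate is the critical point of the quadratic form of the block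
   matrix. There the form takes the value [y *m S *m y^T]. *)
move=> y y0; have := pG (row_mx (- (y *m u^T *m invmx a)) y).
rewrite quad_block mulNmx mulmxKV// addNr mul0mx add0r mulNmx /S mulmxBr addrC.
rewrite !mulmxA; apply.
apply: contra_neq y0 => /(congr1 (@rsubmx _ _ _ _)).
by rewrite row_mxKr linear0.
Qed.

(** The matrix determinant lemma: both sides compute the determinant of the bordered matrix [M], one
    by eliminating its corner [1], the other by eliminating [G]. *)
Lemma det_rank1_update k (G : 'M[R]_k) (w : 'cV_k) : G \in unitmx ->
  \det (w *m w^T + G) = \det G * (1 + (w^T *m invmx G *m w) ord0 ord0).
Proof.
move=> uG.
pose M := block_mx (1%:M : 'M[R]_1) (- w^T) w G.
have -> : \det (w *m w^T + G) = \det M.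
  have -> : M = block_mx 1%:M 0 w 1%:M *m block_mx 1%:M (- w^T) 0 (w *m w^T + G).
    rewrite mulmx_block !mul1mx !mul0mx ?mulmx0 ?mulmx1 !addr0.
    by rewrite mulmxN addrA addNr add0r.
  by rewrite det_mulmx det_lblock !det1 !mul1r det_ublock det1 mul1r.
have -> : M = block_mx (1%:M + w^T *m invmx G *m w) (- w^T *m invmx G) 0 1%:M
    *m block_mx 1%:M 0 w G.
  rewrite mulmx_block !mul1mx !mul0mx ?mulmx0 ?mulmx1 !add0r mulmxKV//.
  by rewrite !mulNmx addrK.
rewrite det_mulmx det_lblock det_ublock !det1 mulr1 mul1r mulrC; congr (_ * _).
by rewrite [X in \det X]mx11_scalar det_scalar expr1 !mxE eqxx mulr1n.
Qed.

(** Reduces the sign of the form of [invmx G] at [w] to positivity of [G] itself, at the vector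
    [w^T *m invmx G]. *)
Lemma quad_inv k (G : 'M[R]_k) (w : 'cV_k) : posdef G ->
  w^T *m invmx G *m w = (w^T *m invmx G) *m G *m (w^T *m invmx G)^T.
Proof.
move=> pG; have uG := posdef_unitmx pG; case: pG => sG _.
by rewrite trmx_mul trmxK trmx_inv sG mulmxKV// mulmxA.
Qed.

(** This is why tilting a graph cannot decrease its volume: with [w] the gradient of the height, the
    determinant gains a factor of at least 1. *)
Lemma le_det_rank1_update k (G : 'M[R]_k) (w : 'cV_k) : posdef G ->
  \det G <= \det (w *m w^T + G).
Proof.
move=> pG; have uG := posdef_unitmx pG; have dG := posdef_det_gt0 pG.
rewrite det_rank1_update// -[leLHS]mulr1 ler_pM2l// lerDl quad_inv//.
have [->|/pG.2/ltW//] := eqVneq (w^T *m invmx G) 0.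
by rewrite !mul0mx mxE.
Qed.

Lemma det_rank1_update_eq k (G : 'M[R]_k) (w : 'cV_k) : posdef G ->
  \det (w *m w^T + G) = \det G -> w = 0.
Proof.
move=> pG; have uG := posdef_unitmx pG; have dG := posdef_det_gt0 pG.
rewrite det_rank1_update// -[RHS]mulr1 => /(mulfI (lt0r_neq0 dG)).
rewrite -[RHS]addr0 => /addrI; rewrite quad_inv//.
have [e _|/pG.2/gt_eqF /eqP//] := eqVneq (w^T *m invmx G) 0.
by apply: trmx_inj; rewrite -[LHS](mulmxKV uG) e mul0mx trmx0.
Qed.

Lemma posdefZ k (G : 'M[R]_k) a : 0 < a -> posdef G -> posdef (a *: G).
Proof.
move=> a0 [sG pG]; split; first by rewrite linearZ/= sG.
by move=> v /pG h; rewrite -scalemxAr -scalemxAl mxE mulr_gt0.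
Qed.

Lemma posdef_congr k n (G : 'M[R]_n) (J : 'M[R]_(k, n)) : row_free J ->
  posdef G -> posdef (J *m G *m J^T).
Proof.
move=> fJ [sG pG]; split; first by rewrite !trmx_mul trmxK sG mulmxA.
move=> v v0; rewrite (_ : _ *m v^T = (v *m J) *m G *m (v *m J)^T); last first.
  by rewrite trmx_mul !mulmxA.
by apply: pG; apply: contra_neq v0; rewrite -(mul0mx _ J) => /(row_free_inj fJ).
Qed.
End posdef.

(** * Functions of one real variable *)

Section one_variable.
Context (R : realType).
Implicit Types (g dg : R -> R) (s t x y : R).

Lemma is_derive_continuous g x dx : is_derive x 1 g dx -> {for x, continuous g}.
Proof. by move=> [dg _]; apply/differentiable_continuous/derivable1_diffP. Qed.

Lemma is_derive_mvt g dg s t : s < t ->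
  (forall x, s <= x <= t -> is_derive x 1 g (dg x)) ->
  exists2 x, s < x < t & g t - g s = dg x * (t - s).
Proof.
move=> st dgx; have [x|x|x] := @MVT R g dg s t st.
- by rewrite in_itv/= => /andP[sx xt]; apply: dgx; rewrite !ltW.
- apply: continuous_in_subspaceT => y; rewrite inE/= in_itv/= => /dgx.
  exact: is_derive_continuous.
- by rewrite in_itv/=; exists x.
Qed.

Lemma is_derive_homo g dg s t :  s <= t ->
  (forall x, s <= x <= t -> is_derive x 1 g (dg x)) ->
  (forall x, s < x < t -> 0 <= dg x) -> g s <= g t.
Proof.
rewrite le_eqVlt => /predU1P[->//|st] dgx dg0.
have [x /dg0 x0 e] := is_derive_mvt st dgx.
by rewrite -subr_ge0 e mulr_ge0// subr_ge0 ltW.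
Qed.

Lemma is_derive_eq_cst g dg s t : s <= t ->
  (forall x, s <= x <= t -> is_derive x 1 g (dg x)) ->
  (forall x, s < x < t -> dg x = 0) -> g s = g t.
Proof.
rewrite le_eqVlt => /predU1P[->//|st] dgx dg0.
have [x /dg0 x0 e] := is_derive_mvt st dgx.
by apply/esym/eqP; rewrite -subr_eq0 e x0 mul0r.
Qed.

Lemma is_derive_incr g dg s t : s < t ->
  (forall x, s <= x <= t -> is_derive x 1 g (dg x)) ->
  (forall x, s < x < t -> 0 < dg x) -> g s < g t.
Proof.
move=> st dgx dg0.
have [x /dg0 x0 e] := is_derive_mvt st dgx.
by rewrite -subr_gt0 e mulr_gt0// subr_gt0.
Qed.

(* If [dg y < dg x] with [x < y], the increments of [g] over short intervals of equal
   length at the left end [x] and at the right end [y] contradict convexity. *)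
Lemma convex_derive_le g dg :
  convex_function (setT : set R^o) g -> continuous dg ->
  (forall x, is_derive x 1 g (dg x)) ->
  forall x y, x <= y -> dg x <= dg y.
Proof.
move=> cg cdg dgx x y; rewrite le_eqVlt => /predU1P[->//|xy].
rewrite leNgt; apply/negP => dyx.
have conv s p q : 0 <= s <= 1 -> g (s * p + (1 - s) * q) <= s * g p + (1 - s) * g q.
  move=> /andP[s0 s1]; have := cg (Itv01 s0 s1) p q; rewrite !inE => /(_ I I).
  by rewrite !convRE.
(* The midpoint separates the two slopes: by continuity [dg] stays above [r] just after [x] and
   below [r] just before [y]. *)
pose r := (dg x + dg y) / 2.
have [d /= d0 xd] : \forall d \near 0^'+, forall z, x <= z <= x + d -> r < dg z.
  have : \forall z \near x, r < dg z by apply: cvgr_gt (cdg x) _ _; rewrite /r; lra.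
  move=> [e /= e0 xe]; exists e => //= d /=; rewrite sub0r normrN => de d0 z /andP[xz zx].
  by apply: xe => /=; rewrite distrC ger0_norm ?subr_ge0//; move: de; rewrite gtr0_norm//; lra.
have [d' /= d'0 yd] : \forall d \near 0^'+, forall z, y - d <= z <= y -> dg z < r.
  have : \forall z \near y, dg z < r by apply: cvgr_lt (cdg y) _ _; rewrite /r; lra.
  move=> [e /= e0 xe]; exists e => //= d1 /=; rewrite sub0r normrN => de d2 z /andP[xz zx].
  by apply: xe => /=; rewrite ger0_norm ?subr_ge0//; move: de; rewrite gtr0_norm//; lra.
have [D [D0 Dd Dd' Dyx]] : exists D : R, [/\ 0 < D, D < d, D < d' & D < y - x].
  pose m := Num.min (Num.min d d') (y - x).
  have m0 : 0 < m by rewrite !lt_min d0 d'0 subr_gt0.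
  have md : m <= d by rewrite !ge_min lexx.
  have md' : m <= d' by rewrite !ge_min lexx orbT.
  have myx : m <= y - x by rewrite !ge_min lexx !orbT.
  by exists (m / 2); split; lra.
have [z1 z1I e1] : exists2 z, x < z < x + D & g (x + D) - g x = dg z * (x + D - x).
  by apply: is_derive_mvt => //; lra.
have [z2 z2I e2] : exists2 z, y - D < z < y & g y - g (y - D) = dg z * (y - (y - D)).
  by apply: is_derive_mvt => //; lra.
have r1 : r < dg z1.
  by apply: (xd D) => //=; rewrite ?sub0r ?normrN ?gtr0_norm//; lra.
have r2 : dg z2 < r.
  by apply: (yd D) => //=; rewrite ?sub0r ?normrN ?gtr0_norm//; lra.
(* With this weight, [x + D] and [y - D] are the two convex combinations of [x] and [y] with
   exchanged weights. Adding the two convexity inequalities eliminates [s]. *)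
pose s := D / (y - x).
have sI : 0 <= s <= 1 by rewrite divr_ge0 ?ler_pdivrMr ?subr_gt0//; lra.
have sE : s * (y - x) = D by rewrite divfK// subr_eq0 gt_eqF.
have := conv s y x sI; have := conv s x y sI.
have -> : s * x + (1 - s) * y = y - D by rewrite -sE; ring.
have -> : s * y + (1 - s) * x = x + D by rewrite -sE; ring.
move=> h1 h2.
have : g (x + D) - g x <= g y - g (y - D) by lra.
rewrite e1 e2 (_ : x + D - x = D); last by ring.
rewrite (_ : y - (y - D) = D); last by ring.
by rewrite ler_pM2r// leNgt (lt_trans r2 r1).
Qed.

(** The mean value theorem on either side of the intermediate point gives slopes [dg p < dg q], and
    the convexity gap is their difference times [r * (1 - r) * (y - x)]. *)
Lemma derive_incr_strictly_convex g dg s t :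
  (forall x, s <= x <= t -> is_derive x 1 g (dg x)) ->
  (forall x y, s <= x -> x < y -> y <= t -> dg x < dg y) ->
  strictly_convex_on `[s, t] g.
Proof.
move=> dgx idg x y r; rewrite /= !in_itv/= => xI yI xy rI.
wlog xy' : x y r xI yI xy rI / x < y.
  move=> H; move: (xy); rewrite neq_lt => /orP[|yx]; first exact: H.
  have yx0 : y != x by rewrite lt_eqF.
  have rI' : 0 < 1 - r < 1 by move: rI; lra.
  have := H y x (1 - r) yI xI yx0 rI' yx.
  by rewrite (_ : 1 - (1 - r) = r); [rewrite addrC [in ltRHS]addrC|ring].
have [r0 r1] := andP rI.
set z := r * x + (1 - r) * y.
have xz : x < z by rewrite /z; nra.
have zy : z < y by rewrite /z; nra.
have [p pI e1] : exists2 p, x < p < z & g z - g x = dg p * (z - x).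
  by apply: is_derive_mvt => // w wI; apply: dgx; move: wI xI yI; lra.
have [q qI e2] : exists2 q, z < q < y & g y - g z = dg q * (y - z).
  by apply: is_derive_mvt => // w wI; apply: dgx; move: wI xI yI; lra.
have pq : dg p < dg q by apply: idg; move: pI qI xI yI; lra.
have -> : g y = g z + dg q * (r * (y - x)).
  by rewrite -[RHS]addrC -(_ : y - z = r * (y - x)) -?e2 /z; ring.
have -> : g x = g z - dg p * ((1 - r) * (y - x)).
  by rewrite -(_ : z - x = (1 - r) * (y - x)) -?e1 /z; ring.
rewrite -subr_gt0.
have -> : r * (g z - dg p * ((1 - r) * (y - x))) +
   (1 - r) * (g z + dg q * (r * (y - x))) - g z = (dg q - dg p) * (r * (1 - r) * (y - x)).
  by ring.
by rewrite !mulr_gt0 ?subr_gt0.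
Qed.

Lemma continuous_antiderivative g b : continuous g -> exists V : R -> R,
  [/\ V b = 0, forall t, b <= t -> is_derive t 1 V (g t) &
    forall t, b <= t ->
      (\int[lebesgue_measure]_(s in `[b, t]) (g s)%:E = (V t)%:E)%E].
Proof.
move=> cg.
(* Integrating from [b - 1] makes [b] an interior point, so that the derivative at [b] is two-sided
   as well. *)
pose F t := (\int[lebesgue_measure]_(s in `[(b - 1), t]) (g s))%R.
have dF t : b - 1 < t -> is_derive t 1 F (g t).
  move=> bt.
  have [] := @continuous_FTC1_closed R g (b - 1) t (t + 1) _ _ bt _.
  - by rewrite ltrDl.
  - apply: continuous_compact_integrable; first exact: segment_compact.
    exact: continuous_subspaceT.
  - exact: cg.
  by move=> dF e; split; [exact: dF|rewrite -derive1E; exact: e].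
have dV t : b <= t -> is_derive t 1 (fun t => F t - F b) (g t).
  move=> bt; have ? := dF t (ltac:(move: bt; lra)).
  by apply: is_derive_eq; rewrite subr0.
exists (fun t => F t - F b); split => //; first by rewrite subrr.
move=> t; rewrite le_eqVlt => /predU1P[<-|bt].
  by rewrite set_itv1 integral_set1 subrr.
rewrite (@continuous_FTC2 _ g F b t)//.
- exact: continuous_subspaceT.
- have cF x : b <= x -> {for x, continuous F}.
    by move=> bx; apply: is_derive_continuous (dF x _); move: bx; lra.
  split.
  + move=> x; rewrite in_itv/= => /andP[bx _].
    by have [] := dF x (ltac:(move: bx; lra)).
  + by apply: cvg_at_right_filter; apply: cF.
  + by apply: cvg_at_left_filter; apply: cF; exact: ltW.
- move=> x; rewrite in_itv/= => /andP[bx _].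
  by have [_ <-] := dF x (ltac:(move: bx; lra)); rewrite derive1E.
Qed.

End one_variable.

(** * The calibrating function and its zero set *)

Section calibration.
Context (R : realType) (f : R -> R).
Hypothesis f_gt0 : forall t, 0 < f t.

(** Here [u1] and [u2] are the first two derivatives of [ln f], built from those of [f]. The
    calibration argument works with them and with [f' = f * u1]. *)
Lemma smooth_ln : smooth_on setT f -> exists u1 u2 : R -> R,
  [/\ forall t : R, is_derive t 1 (fun t => ln (f t)) (u1 t),
      forall t : R, is_derive t 1 u1 (u2 t), continuous u2 &
      forall t : R, is_derive t 1 f (f t * u1 t)].
Proof.
move=> /(_ 2%N) /= [df /(_ 1) [ddf /(_ 1) cddf]].
pose f1 (t : R) : R := 'D_1 f t; pose f2 (t : R) : R := 'D_1 f1 t.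
have f1P (t : R) : is_derive t 1 f (f1 t).
  by apply: derivableP; apply: diff_derivable; exact: df.
have f2P (t : R) : is_derive t 1 f1 (f2 t).
  by apply: derivableP; apply: diff_derivable; exact: ddf.
have fn0 t : f t != 0 by rewrite gt_eqF.
have cf : continuous f by move=> t; apply: is_derive_continuous (f1P t).
have cf1 : continuous f1 by move=> t; apply: is_derive_continuous (f2P t).
have cf2 : continuous f2 by move=> t; exact: cddf.
have vP (t : R) : is_derive t 1 (fun s => (f s)^-1) (- f1 t / f t ^+ 2).
  have [df1 e1] := f1P t; split; first exact: derivableV.
  by rewrite deriveV// e1 /GRing.scale/= mulNr mulNr mulrC.
exists (fun t => (f t)^-1 * f1 t), (fun t => (f t)^-1 * f2 t - (f1 t * f1 t) / (f t * f t)).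
split=> t.
- exact: is_derive1_comp (@is_derive1_ln R (f t) (f_gt0 t)) (f1P t).
- have h := is_deriveM (vP t) (f2P t).
  by apply: (@is_derive_eq _ _ _ _ _ _ _ _ h); rewrite /GRing.scale/=; field.
- apply: cvgB; apply: cvgM; first exact: cvgV (fn0 t) (cf t).
  + exact: cf2.
  + by apply: cvgM; exact: cf1.
  + by apply: cvgV; [rewrite mulf_neq0|apply: cvgM; exact: cf].
- by rewrite mulVKf.
Qed.

Context (u1 u2 : R -> R).
Hypothesis lnfP : forall t : R, is_derive t 1 (fun t => ln (f t)) (u1 t).
Hypothesis u1P : forall t : R, is_derive t 1 u1 (u2 t).
Hypothesis u2_continuous : continuous u2.
Hypothesis fP : forall t : R, is_derive t 1 f (f t * u1 t).
Hypothesis u1_le : forall s t, s <= t -> u1 s <= u1 t.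

(* If [u1 s < u1 t] then [u2] is positive somewhere in between, hence on a small
   interval, where [ln f] is strictly convex. *)
Lemma nowhere_strictly_log_convex_eq (J : set R) s t : is_interval J ->
  nowhere_strictly_log_convex f J -> J s -> J t -> u1 s = u1 t.
Proof.
move=> iJ nJ; wlog st : s t / s < t.
  move=> H Js Jt; case: (ltgtP s t) => [|ts|->//]; first by move/H; apply.
  by apply/esym/H.
move=> Js Jt; apply/le_anti; rewrite u1_le ?(ltW st)//= leNgt; apply/negP => us.
have [x xI e] : exists2 x, s < x < t & u1 t - u1 s = u2 x * (t - s).
  by apply: is_derive_mvt.
have u2x : 0 < u2 x.
  by rewrite -(@pmulr_lgt0 _ (t - s)) ?subr_gt0// -e subr_gt0.
have [d /= d0 xd] : \forall y \near x, 0 < u2 y by apply: cvgr_gt (@u2_continuous x) _ u2x.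
have [D [D0 Dd Dt]] : exists D : R, [/\ 0 < D, D < d & D < t - x].
  have tx : 0 < t - x by rewrite subr_gt0; case/andP: xI.
  by case: (leP d (t - x)) => ?; [exists (d / 2)|exists ((t - x) / 2)]; split; lra.
apply: (nJ x (x + D)); first lra.
  move=> y /=; rewrite in_itv/= => yI; apply: (iJ s t) => //; move: yI xI; lra.
apply: (@derive_incr_strictly_convex _ _ u1) => y z xy yz zD.
apply: is_derive_incr => // w wI.
apply: xd => /=; rewrite distrC ger0_norm; move: wI; lra.
Qed.

Context (k : nat) (b c : R) (V : R -> R).
Hypothesis bc : b <= c.
Hypothesis VP : forall t : R, b <= t -> is_derive t 1 V (f t ^+ k).

Let slope := k%:R * u1 c.

(** The function [e] of the overview. The multiple of [V] is chosen so that the derivative of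
    [calib] vanishes at [c]. *)
Definition calib t := f t ^+ k - f c ^+ k - slope * (V t - V c).

Lemma is_derive_calib t : b <= t ->
  is_derive t 1 calib (k%:R * (u1 t - u1 c) * f t ^+ k).
Proof.
move=> bt; rewrite /calib; have ? := VP bt; have ? := fP t.
have ? : is_derive t 1 (fun s => f s ^+ k) (k%:R * u1 t * f t ^+ k).
  rewrite -exprfctE; apply: is_derive_eq; rewrite /GRing.scale/=.
  (* The power rule produces the exponent [k.-1], which forces a separate case for [k = 0]. *)
  by case: (k) => [|j] /=; rewrite ?mul0r// [in RHS]exprS; ring.
rewrite (_ : (fun _ => _) = (fun s => f s ^+ k) - cst (f c ^+ k) -
    slope *: (V - cst (V c))); last first.
  by apply/funext.
apply: is_derive_eq; rewrite /slope /GRing.scale/=; ring.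
Qed.

Let dcalib t := k%:R * (u1 t - u1 c) * f t ^+ k.

Lemma calib_ge t : c <= t -> forall x, t <= x -> calib t <= calib x.
Proof.
move=> ct x tx; apply: (@is_derive_homo _ calib dcalib) => // y yI.
  by apply: is_derive_calib; move: yI ct bc; lra.
rewrite mulr_ge0//; last by rewrite exprn_ge0// ltW.
by rewrite mulr_ge0// subr_ge0 u1_le//; move: yI ct; lra.
Qed.

Lemma calib_le t : b <= t -> forall x, t <= x -> x <= c -> calib x <= calib t.
Proof.
move=> bt x tx xc; rewrite -lerN2.
apply: (@is_derive_homo _ (- calib) (- dcalib)) => // y yI.
  by apply: is_deriveN; apply: is_derive_calib; move: yI bt; lra.
rewrite oppr_ge0 mulr_le0_ge0//; last by rewrite exprn_ge0// ltW.
by rewrite mulr_ge0_le0// subr_le0 u1_le//; move: yI xc; lra.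
Qed.

Lemma calib_c : calib c = 0. Proof. by rewrite /calib !subrr mulr0 subr0. Qed.

Lemma calib_ge0 t : b <= t -> 0 <= calib t.
Proof.
move=> bt; rewrite -calib_c; have [ct|/ltW tc] := leP c t; first exact: calib_ge.
exact: calib_le.
Qed.

Let J := [set t | b <= t /\ calib t = 0].

(** Since [calib] decreases up to [c] and increases after it, its value at a point between two zeros
    is at most the value at the zero farther from [c] on the same side, hence at most 0. *)
Lemma calib0_interval : is_interval J.
Proof.
move=> x y [bx ex] [yb ey] z /andP[xz zy].
have bz : b <= z by apply: le_trans xz.
split => //; apply/le_anti; rewrite calib_ge0// andbT.
have [cz|/ltW zc] := leP c z; first by rewrite -ey calib_ge.
by rewrite -ex calib_le.
Qed.

(** Inside a segment of zeros the derivative of [calib] vanishes. As [k] and [f] are positive, this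
    forces [u1 = u1 c], so [ln f] is affine there and strict convexity fails at the midpoint. *)
Lemma calib0_nowhere : (0 < k)%N -> nowhere_strictly_log_convex f J.
Proof.
move=> k0 s t st stJ sc.
have u1E x : s < x < t -> u1 x = u1 c.
  move=> /andP[sx xt].
  have [bx _] : J x by apply: stJ; rewrite /= in_itv/= !ltW.
  have [_ ] := is_derive_calib bx.
  have <- : 'D_1 (cst (0 : R)) x = 'D_1 calib x.
    apply: near_eq_derive; near=> y; rewrite /cst; apply/esym.
    suff [] : J y by [].
    apply: stJ; rewrite /= in_itv/=; apply/andP; split; near: y.
      by near do rewrite ltW//; exact: lt_nbhsr.
    by near do rewrite ltW//; exact: lt_nbhsl.
  rewrite derive_cst => /esym/eqP; rewrite !mulf_eq0 subr_eq0 pnatr_eq0 gtn_eqF//=.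
  by rewrite expf_eq0 (gt_eqF (f_gt0 x)) andbF orbF => /eqP.
have := sc s t (1/2).
rewrite /= !in_itv/= !lexx (ltW st) (lt_eqF st) => /(_ isT isT isT).
have [x xI e1] := @is_derive_mvt _ _ u1 s ((s + t) / 2) (ltac:(lra)) (fun z _ => lnfP z).
have [y yI e2] := @is_derive_mvt _ _ u1 ((s + t) / 2) t (ltac:(lra)) (fun z _ => lnfP z).
rewrite u1E in e1; last by move: xI; lra.
rewrite u1E in e2; last by move: yI; lra.
rewrite (_ : 1/2 * s + _ = (s + t) / 2); last by field.
have h : 0 < (1 / 2 : R) < 1 by lra.
move=> /(_ h).
move: e1 e2; lra.
Unshelve. all: by end_near. Qed.

(** On such an interval through [c] the slope [u1] is constant, so [calib] has zero derivative
    between [c] and [t]. *)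
Lemma calib_eq0 (K : set R) t : is_interval K -> nowhere_strictly_log_convex f K ->
  K c -> K t -> b <= t -> calib t = 0.
Proof.
move=> iK nK Kc Kt bt; rewrite -calib_c.
have dK x : K x -> dcalib x = 0.
  by move=> Kx; rewrite /dcalib (nowhere_strictly_log_convex_eq iK nK Kx Kc) subrr mulr0 mul0r.
have [ct|/ltW tc] := leP c t; first apply/esym;
  apply: (@is_derive_eq_cst _ calib dcalib) => // x xI.
- by apply: is_derive_calib; move: xI bc; lra.
- by apply: dK; apply: (iK c t) => //; move: xI; lra.
- by apply: is_derive_calib; move: xI bt; lra.
- by apply: dK; apply: (iK t c) => //; move: xI; lra.
Qed.

End calibration.

(** * Series of integrals of nonnegative functions *)

Section lower_integral.
Context d (T : measurableType d) (R : realType) (mu : {measure set T -> \bar R}).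
Local Open Scope ereal_scope.
Import HBNNSimple.

(* The integral of a nonnegative function is the supremum of the integrals of the
   simple functions below it, so no measurability of [D] and [f] is needed. *)
Lemma ge0_integral_setD_null (D N : set T) (f : T -> \bar R) :
  measurable N -> mu N = 0 -> (forall x, 0 <= f x) ->
  \int[mu]_(x in D) f x = \int[mu]_(x in D `\` N) f x.
Proof.
move=> mN N0 f0; rewrite !ge0_integralE//; apply/le_anti/andP; split.
  apply: ge_ereal_sup => _ [h hf <-].
  have mN' : measurable (~` N) by exact: measurableC.
  (* A simple function below the integrand is cut off on [N]; its integral does not change because
     [N] is null. *)
  apply: ereal_sup_ge; exists (sintegral mu (proj_nnsfun h mN')).
    exists (proj_nnsfun h mN') => // x; have := hf x.
    rewrite -mrestrict !patchE in_setC in_setD.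
    by have [xN|xN] := boolP (x \in N); rewrite /= ?andbF ?andbT.
  rewrite -mrestrict -integral_nnsfun// -integralT_nnsfun.
  rewrite (@ge0_negligible_integral _ _ _ _ setT N)//; first by rewrite setTD.
  - exact/measurable_EFinP.
  - by move=> x _; rewrite lee_fin.
apply: le_ereal_sup => _ [h hf <-]; exists h => // x.
apply: le_trans (hf x) _; rewrite !patchE in_setD.
by case: (x \in D) => //=; case: ifP.
Qed.
End lower_integral.

Section series_of_integrals.
Context d (T : measurableType d) (R : realType) (mu : {measure set T -> \bar R}).
Context (D : nat -> set T).
Hypothesis mD : forall i, measurable (D i).
Implicit Types u v w : nat -> T -> R.
Local Open Scope ereal_scope.

(** Nonnegativity and measurability let integrals and series be added and scaled even when infinite.
    Both are asked on the patches only, where the densities are controlled. *)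
Definition admissible u := forall i,
  measurable_fun (D i) (u i) /\ forall x, D i x -> (0 <= u i x)%R.

(* One integral for each patch of the floor. *)
Definition sumint u := \sum_(0 <= i <oo) \int[mu]_(x in D i) (u i x)%:E.

Lemma admissibleD u v : admissible u -> admissible v ->
  admissible (fun i x => u i x + v i x)%R.
Proof.
move=> au av i; have [mu_ u0] := au i; have [mv v0] := av i; split.
  exact: measurable_funD.
by move=> x Dx; rewrite addr_ge0 ?u0 ?v0.
Qed.

Lemma admissibleM u v : admissible u -> admissible v ->
  admissible (fun i x => u i x * v i x)%R.
Proof.
move=> au av i; have [mu_ u0] := au i; have [mv v0] := av i; split.
  exact: measurable_funM.
by move=> x Dx; rewrite mulr_ge0 ?u0 ?v0.
Qed.

Lemma admissibleZ a u : (0 <= a)%R -> admissible u ->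
  admissible (fun i x => a * u i x)%R.
Proof. by move=> a0 au; apply: admissibleM. Qed.

Lemma term_ge0 u i : admissible u -> 0 <= \int[mu]_(x in D i) (u i x)%:E.
Proof. by move=> au; apply: integral_ge0 => x /(au i).2; rewrite lee_fin. Qed.

Lemma sumint_ge0 u : admissible u -> 0 <= sumint u.
Proof. by move=> au; apply: nneseries_ge0 => i _ _; exact: term_ge0. Qed.

Lemma sumintD u v : admissible u -> admissible v ->
  sumint (fun i x => u i x + v i x)%R = sumint u + sumint v.
Proof.
move=> au av; rewrite /sumint -nneseriesD => [|i _ _|i _ _]; try exact: term_ge0.
apply: eq_eseriesr => i _; rewrite -ge0_integralD//.
- by move=> x /(au i).2; rewrite lee_fin.
- by apply/measurable_EFinP; case: (au i).
- by move=> x /(av i).2; rewrite lee_fin.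
- by apply/measurable_EFinP; case: (av i).
Qed.

Lemma sumintZ a u : (0 <= a)%R -> admissible u ->
  sumint (fun i x => a * u i x)%R = a%:E * sumint u.
Proof.
move=> a0 au; rewrite /sumint -nneseriesZl => [|i _]; last exact: term_ge0.
apply: eq_eseriesr => i _; rewrite -ge0_integralZl_EFin//.
- by move=> x /(au i).2; rewrite lee_fin.
- by apply/measurable_EFinP; case: (au i).
Qed.

Lemma eq_sumint u v : (forall i x, D i x -> u i x = v i x) -> sumint u = sumint v.
Proof.
move=> uv; apply: eq_eseriesr => i _; apply: eq_integral => x; rewrite inE => Dx.
by rewrite uv.
Qed.

Lemma ae_eq_sumint u v : admissible u -> admissible v ->
  (forall i, {ae mu, forall x, D i x -> u i x = v i x}) -> sumint u = sumint v.
Proof.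
move=> au av uv; apply: eq_eseriesr => i _; apply: ge0_ae_eq_integral => //.
- by apply/measurable_EFinP; case: (au i).
- by apply/measurable_EFinP; case: (av i).
- by move=> x /(au i).2; rewrite lee_fin.
- by move=> x /(av i).2; rewrite lee_fin.
- by apply: filterS (uv i) => x e Dx; rewrite e.
Qed.

Lemma sumint_eq0 u : admissible u -> sumint u = 0 ->
  forall i, {ae mu, forall x, D i x -> u i x = 0%R}.
Proof.
move=> au u0 i.
have : \int[mu]_(x in D i) `|(u i x)%:E| = 0.
  apply/le_anti; rewrite integral_ge0// andbT -u0.
  rewrite (eq_integral (fun x => (u i x)%:E)) => [|x]; last first.
    by rewrite inE => /(au i).2 u0x; rewrite gee0_abs// lee_fin.
  rewrite /sumint (@nneseriesD1 _ _ i)//; last by move=> j _; exact: term_ge0.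
  by rewrite leeDl// nneseries_ge0// => j _ _; exact: term_ge0.
have mui : measurable_fun (D i) (EFin \o u i) by apply/measurable_EFinP; case: (au i).
move/(ae_eq_integral_abs _ (mD i) mui); apply: filterS => x h Dx.
by have := h Dx; rewrite /= => -[].
Qed.

Lemma le_sumint u v : admissible u -> admissible v ->
  (forall i x, D i x -> u i x <= v i x)%R -> sumint u <= sumint v.
Proof.
move=> au av uv; apply: lee_nneseries => [i _ _|i _]; first exact: term_ge0.
apply: ge0_le_integral => //.
- by move=> x /(au i).2; rewrite lee_fin.
- by apply/measurable_EFinP; case: (au i).
- by apply/measurable_EFinP; case: (av i).
- by move=> x /uv; rewrite lee_fin.
Qed.

Lemma fin_num_addeI (x y z : \bar R) : x \is a fin_num -> x + y = x + z -> y = z.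
Proof. by move=> xf e; rewrite -(addeK y xf) [y + x]addeC e [x + z]addeC addeK. Qed.

Lemma sumint_fin_num u : admissible u -> sumint u < +oo -> sumint u \is a fin_num.
Proof. by move=> au uoo; rewrite ge0_fin_numE// sumint_ge0. Qed.

(* The sums may be infinite and [m] may be negative: [m] is split into its positive
   and negative parts to keep every integrand nonnegative. *)
Lemma sumint_calibration (rho A B E : nat -> T -> R) (p q m : R) :
  admissible rho -> admissible A -> admissible B -> admissible E ->
  (0 <= p)%R -> (0 <= q)%R ->
  (forall i x, D i x ->
     A i x = p * rho i x + m * (B i x - q * rho i x) + E i x)%R ->
  sumint rho < +oo -> sumint B = q%:E * sumint rho ->
  sumint A = p%:E * sumint rho + sumint E.
Proof.
move=> arho aA aB aE p0 q0 AE rhooo BE.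
have frho := sumint_fin_num arho rhooo.
pose m1 := Num.max m 0%R; pose m2 := Num.max (- m)%R 0%R.
have m10 : (0 <= m1)%R by rewrite le_max lexx orbT.
have m20 : (0 <= m2)%R by rewrite le_max lexx orbT.
have mE : m = (m1 - m2)%R.
  by rewrite /m1 /m2 !maxElt; case: (ltP m 0%R); case: (ltP (- m)%R 0%R); lra.
(* [X] collects the terms with a negative sign: pointwise [X + A = p * rho + Y + E]. As [X] and [Y]
   have the same finite total, they cancel. *)
pose X i x := (m1 * (q * rho i x) + m2 * B i x)%R.
pose Y i x := (m1 * B i x + m2 * (q * rho i x))%R.
have aqrho := admissibleZ q0 arho.
have aX : admissible X by apply: admissibleD; exact: admissibleZ.
have aY : admissible Y by apply: admissibleD; exact: admissibleZ.
have tX : sumint X = (m1%:E * (q%:E * sumint rho)) + (m2%:E * (q%:E * sumint rho)).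
  by rewrite sumintD ?sumintZ ?BE//; exact: admissibleZ.
have tY : sumint Y = sumint X.
  by rewrite tX sumintD ?sumintZ ?BE//; exact: admissibleZ.
apply: (@fin_num_addeI (sumint X)).
  by rewrite tX fin_numD !fin_numM.
have aprho := admissibleZ p0 arho.
rewrite -sumintZ// -[in RHS]tY -!sumintD//; last exact: admissibleD.
by apply: eq_sumint => i x Dx; rewrite /X /Y AE// mE; ring.
Qed.

(** The difference [v - u] is admissible, and its total is zero by cancelling the finite total of
    [u]. *)
Lemma sumint_le_eq u v : admissible u -> admissible v ->
  (forall i x, D i x -> u i x <= v i x)%R -> sumint u = sumint v -> sumint u < +oo ->
  forall i, {ae mu, forall x, D i x -> u i x = v i x}.
Proof.
move=> au av uv e uoo.
have ad : admissible (fun i x => v i x - u i x)%R.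
  move=> i; split; first by apply: measurable_funB; [case: (av i)|case: (au i)].
  by move=> x Dx; rewrite subr_ge0 uv.
have : sumint (fun i x => v i x - u i x)%R = 0.
  have : sumint u + sumint (fun i x => v i x - u i x)%R = sumint u + 0.
    rewrite -sumintD// adde0 [RHS]e; apply: eq_sumint => i x _.
    by rewrite addrC subrK.
  exact/fin_num_addeI/sumint_fin_num.
move=> /(sumint_eq0 ad) h i; apply: filterS (h i) => x hx Dx.
by apply/esym/eqP; rewrite -subr_eq0 hx.
Qed.

Lemma sumint_ae_le_eq u v : admissible u -> admissible v ->
  (forall i, {ae mu, forall x, D i x -> (u i x <= v i x)%R}) ->
  sumint u = sumint v -> sumint u < +oo ->
  forall i, {ae mu, forall x, D i x -> u i x = v i x}.
Proof.
move=> au av uv e uoo i.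
(* [w] agrees with [v] almost everywhere and dominates [u] everywhere, which reduces to the
   preceding lemma. *)
pose w i x := Num.max (u i x) (v i x).
have aw : admissible w.
  move=> j; split; first by apply: measurable_maxr; [case: (au j)|case: (av j)].
  by move=> x Dx; rewrite le_max (au j).2.
have wv j : {ae mu, forall x, D j x -> v j x = w j x}.
  by apply: filterS (uv j) => x h Dx; rewrite /w max_r// h.
have ew : sumint u = sumint w by rewrite e; exact: ae_eq_sumint.
have le_w j x : D j x -> (u j x <= w j x)%R by rewrite le_max lexx.
have := sumint_le_eq au aw le_w ew uoo i; apply: filterS2 (wv i) => x h1 h2 Dx.
by rewrite h2// -h1.
Qed.

End series_of_integrals.

(** * Borel measurability on row vectors *)

Section borel_rV.
Context (R : realType) (k : nat).
Implicit Types (D U : set 'rV[R]_k) (x y : 'rV[R]_k).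

(** Balls of the max norm, written by coordinates to match the generators of the sigma-algebra and
    the recursion defining [lebesgue_rV]. *)
Definition cube x (e : R) : set 'rV[R]_k :=
  [set y | forall j, `|y ord0 j - x ord0 j| < e].

Lemma nbhs_cubeP x U : nbhs x U <-> exists2 e, 0 < e & cube x e `<=` U.
Proof.
split=> [/nbhs_ballP[e /= e0 xe]|[e e0 xe]].
  exists e => // y yx; apply: xe; split=> // i j; rewrite !ord1.
  by rewrite -ball_normE /= distrC.
apply/nbhs_ballP; exists e => //= y [_ xy]; apply: xe => j.
by have := xy ord0 j; rewrite -ball_normE /= distrC.
Qed.

Lemma measurable_cube x e : measurable (cube x e).
Proof.
have -> : cube x e = \bigcap_(j in [set: 'I_k])
    ((fun y : 'rV[R]_k => y ord0 j : measurableTypeR R) @^-1` ball (x ord0 j) e).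
  apply/seteqP; split => y yx j /=.
    by move=> _; rewrite -ball_normE /= distrC.
  by have := yx j I; rewrite -ball_normE /= distrC.
apply: fin_bigcap_measurable => [|j _]; first exact: finite_finset.
rewrite -[X in measurable X]setTI; apply: measurable_rV_coord => //.
exact: measurable_ball.
Qed.

(** An open set is the countable union of the cubes inside it that have a rational centre and radius
    the inverse of a positive integer. *)
Lemma open_measurable_rV U : open U -> measurable U.
Proof.
move=> oU.
pose F (p : 'rV[rat]_k * nat) : set 'rV[R]_k :=
  [set y | cube (map_mx ratr p.1) p.2.+1%:R^-1 y /\
           cube (map_mx ratr p.1) p.2.+1%:R^-1 `<=` U].
have -> : U = \bigcup_p F p.
  apply/seteqP; split => [x Ux|x [p _ [px]]]; last exact.
  have /nbhs_cubeP[e e0 xe] : nbhs x U by apply: open_nbhs_nbhs.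
  (* Two radii: one from [x] to the rational centre, one from the centre to any point of the
     cube. *)
  have [m me] : exists m : nat, m.+1%:R^-1 + m.+1%:R^-1 < e.
    have := near_infty_natSinv_lt (PosNum (divr_gt0 e0 (ltr0n R 2))).
    by move=> [m _ /(_ m (leqnn m)) /= h]; exists m; rewrite (splitr e) ltrD.
  have m0 : 0 < m.+1%:R^-1 :> R by rewrite invr_gt0.
  have qP j : exists q : rat, `|x ord0 j - ratr q| < m.+1%:R^-1.
    have [|q] := @rat_in_itvoo R (x ord0 j) (x ord0 j + m.+1%:R^-1).
      by rewrite ltrDl.
    by rewrite in_itv/= => /andP[q1 q2]; exists q; rewrite distrC gtr0_norm ?subr_gt0// ltrBlDl.
  pose q := \row_j sval (cid (qP j)).
  exists (q, m) => //; split.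
    by move=> j; rewrite !mxE; case: cid.
  move=> y /= yq; apply: xe => j; apply: lt_trans me.
  rewrite -[y ord0 j](subrK (map_mx ratr q ord0 j)) -addrA.
  rewrite (le_lt_trans (ler_normD _ _))// ltrD//.
  by rewrite !mxE distrC; case: cid.
apply: countable_bigcupT_measurable; first exact: countableP.
move=> p; have [h|h] := pselect (cube (map_mx ratr p.1) p.2.+1%:R^-1 `<=` U).
  rewrite (_ : F p = cube (map_mx ratr p.1) p.2.+1%:R^-1).
    exact: measurable_cube.
  by apply/seteqP; split => // x [].
by rewrite (_ : F p = set0)//; apply/seteqP; split => // x [].
Qed.

(** [D] is typically an open set minus a null set. The neighbourhoods being taken in the whole
    space, [U] can be replaced by its interior. *)
Lemma measurable_rel_open D U : measurable D ->
  (forall x, D x -> U x -> nbhs x U) -> measurable (D `&` U).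
Proof.
move=> mD oU; rewrite (_ : D `&` U = D `&` U^°).
  by apply: measurableI => //; apply: open_measurable_rV; exact: open_interior.
apply/seteqP; split => x [Dx Ux]; split => //; first exact: oU.
exact: interior_subset.
Qed.

Lemma measurable_fun_continuous D (h : 'rV[R]_k -> R) : measurable D ->
  (forall x, D x -> {for x, continuous h}) ->
  measurable_fun D (h : _ -> measurableTypeR R).
Proof.
move=> mD ch; apply: (measurability _ (RGenOInfty.measurableE R)).
move=> _ [_ [r ->] <-]; apply: measurable_rel_open => // x Dx /=.
by rewrite in_itv/= andbT => rx; near do rewrite /= in_itv/= andbT;
  apply: cvgr_gt (ch x Dx) _ rx.
Unshelve. all: by end_near. Qed.

Lemma differentiable_cube (h : 'rV[R]_k -> R) x (e : R) : differentiable h x -> 0 < e ->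
  exists2 r : R, 0 < r & forall v : 'rV[R]_k, (forall i, `|v ord0 i| < r) ->
    `|h (v + x) - h x - 'd h x v| <= e * `|v|.
Proof.
move=> dh e0; have /eqaddoP/(_ _ e0)/nbhs_cubeP[r r0 hr] := diff_locally dh.
exists r => // v vr.
have := hr v; rewrite /= opprD addrA; apply.
by move=> j; rewrite mxE subr0.
Qed.

End borel_rV.

Section cube_mass.
Context (R : realType).

(** Hence a null set contains no cube. In dimension 0 the condition on coordinates is vacuous and
    the cube is the point carrying the Dirac mass. *)
Lemma lebesgue_cube_gt0 k (x : 'rV[R]_k) (e : R) : 0 < e ->
  (0 < lebesgue_rV R k (cube x e))%E.
Proof.
move=> e0; elim: k x => [|k IH] x.
  rewrite /= diracE mem_set ?lte01// => j.
  by have := ltn_ord j; rewrite ltn0.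
change ('rV[R]_(1 + k)) in x.
have -> : lebesgue_rV R k.+1 (cube x e) =
    (lebesgue_measure \x lebesgue_rV R k)%E
      (ball (x ord0 (lshift k ord0)) e `*` cube (rsubmx x) e).
  rewrite /= /lebesgue_rV_step /pushforward; congr (_ _).
  apply/seteqP; split => -[t y] /=.
    move=> h; split => [|j].
      have := h (lshift k ord0); rewrite /consrV row_mxEl mxE eqxx mulr1n/=.
      by rewrite -ball_normE /= distrC.
    by have := h (rshift 1 j); rewrite /consrV row_mxEr mxE.
  move=> [h1 h2] j; case: (split_ordP j) => i ->.
    rewrite [i]ord1 /consrV row_mxEl mxE eqxx mulr1n/=.
    by move: h1; rewrite -ball_normE /= distrC.
  by have := h2 i; rewrite /consrV row_mxEr mxE.
rewrite product_measure1E; [|exact: measurable_ball|exact: measurable_cube].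
have b0 : (0 < lebesgue_measure (ball (x ord0 (lshift k ord0)) e))%E.
  by rewrite lebesgue_measure_ball ?ltW// lte_fin mulrn_wgt0.
exact: mule_gt0 b0 (IH _).
Qed.
End cube_mass.

(** * Measurability of partial derivatives *)

Section partial_derivatives.
Context (R : realType) (k : nat) (h : 'rV[R]_k -> R) (j : 'I_k).
Implicit Types (D : set 'rV[R]_k) (x y : 'rV[R]_k).

Let dj x := 'd h x (delta_mx 0 j) : R.

(* [y] lies in the thin truncated open cone with apex [x] around the j-th
   coordinate direction, and the slope of [h] from [x] to [y] is less than
   [r + e]. *)
Let steep (r e : R) x y :=
  [/\ 0 < y ord0 j - x ord0 j < e,
      forall i, i != j -> `|y ord0 i - x ord0 i| < e * (y ord0 j - x ord0 j) &
      h y - h x < (r + e) * (y ord0 j - x ord0 j)].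

(** For fixed [y], [steep] consists of finitely many strict inequalities between functions
    continuous at the apex. *)
Lemma steep_open r e x y : 0 < e -> {for x, continuous h} -> steep r e x y ->
  nbhs x (fun z => steep r e z y).
Proof.
move=> e0 ch [/andP[y0 ye] yi yh].
have cc i : {for x, continuous (fun z : 'rV[R]_k => y ord0 i - z ord0 i)}.
  apply: (@continuousB _ _ _ (cst (y ord0 i)) (fun z : 'rV[R]_k => z ord0 i)).
    exact: cst_continuous.
  exact: (@coord_continuous R 1 k ord0 i).
have ccM a : {for x, continuous (fun z : 'rV[R]_k => a * (y ord0 j - z ord0 j))}.
  apply: (@continuousM _ _ (cst a) (fun z : 'rV[R]_k => y ord0 j - z ord0 j)).
    exact: cst_continuous.
  exact: cc.
have c1 : nbhs x [set z : 'rV[R]_k | 0 < y ord0 j - z ord0 j] by apply: cvgr_gt (cc j) _ y0.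
have c2 : nbhs x [set z : 'rV[R]_k | y ord0 j - z ord0 j < e] by apply: cvgr_lt (cc j) _ ye.
have c3 : nbhs x [set z : 'rV[R]_k | h y - h z < (r + e) * (y ord0 j - z ord0 j)].
  have c : {for x, continuous (fun z : 'rV[R]_k => (r + e) * (y ord0 j - z ord0 j) + h z)}.
    by apply: (@continuousD _ _ _ _ h); [exact: ccM|exact: ch].
  have : nbhs x [set z : 'rV[R]_k | h y < (r + e) * (y ord0 j - z ord0 j) + h z].
    by apply: cvgr_gt c _ _; rewrite -ltrBlDr.
  by apply: filterS => z /=; rewrite ltrBlDr.
have c4 : nbhs x [set z : 'rV[R]_k | forall i, i != j ->
    `|y ord0 i - z ord0 i| < e * (y ord0 j - z ord0 j)].
  apply: (@filter_forall _ 'I_k (fun i (z : 'rV[R]_k) =>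
    i != j -> `|y ord0 i - z ord0 i| < e * (y ord0 j - z ord0 j)) _ (nbhs_filter x)) => i.
  have [->|ij] := eqVneq i j; first by apply: nearW.
  have c : {for x, continuous (fun z : 'rV[R]_k =>
      e * (y ord0 j - z ord0 j) - `|y ord0 i - z ord0 i|)}.
    apply: (@continuousB _ _ _ _ (fun z : 'rV[R]_k => `|y ord0 i - z ord0 i|)); first exact: ccM.
    by apply: (@continuous_comp _ _ _ (fun z : 'rV[R]_k => y ord0 i - z ord0 i) Num.norm);
      [exact: cc|exact: norm_continuous].
  have : nbhs x [set z : 'rV[R]_k | 0 < e * (y ord0 j - z ord0 j) - `|y ord0 i - z ord0 i|].
    by apply: cvgr_gt c _ _; rewrite subr_gt0; exact: yi.
  by apply: filterS => z /=; rewrite subr_gt0.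
near=> z; split; [apply/andP; split| |]; near: z => //.
Unshelve. all: by end_near. Qed.

(** Turns a bound on the derivative into a countable union of complements of conditions open in [x].
    On a thin cone the slopes are close to [dj x]; conversely, one point on the axis of the cone
    suffices. *)
Lemma gt_partialP r x : differentiable h x ->
  r < dj x <-> exists m, forall y, ~ steep r m.+1%:R^-1 x y.
Proof.
move=> dh; split.
  move=> rd.
  have [C C0 hC] := linear_lipschitz (diff_continuous dh).
  (* Half of the gap pays for the differentiability error. The other half pays for the deviation
     from the axis, at most [C * q] per unit of height, and for the margin [q] in [steep]. *)
  pose e := (dj x - r) / 2.
  have e0 : 0 < e by rewrite divr_gt0// subr_gt0.
  have [dl dl0 hdl] := differentiable_cube dh e0.
  have [m [m1 m2]] : exists m : nat, m.+1%:R^-1 < dl /\ (C + 1) * m.+1%:R^-1 < e.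
    have C1 : 0 < C + 1 by rewrite addr_gt0.
    have m0 : 0 < Num.min dl (e / (C + 1)) by rewrite lt_min dl0 divr_gt0.
    have := near_infty_natSinv_lt (PosNum m0).
    move=> [m _ /(_ m (leqnn m)) /=]; rewrite lt_min => /andP[h1 h2].
    by exists m; split => //; rewrite mulrC -ltr_pdivlMr.
  set q := m.+1%:R^-1 in m1 m2 *.
  have q0 : 0 < q by rewrite invr_gt0.
  have q1 : q <= 1 by rewrite invf_le1// ler1n.
  exists m => y [/andP[s0 sq] yi yh].
  set s := y ord0 j - x ord0 j in s0 sq yi yh.
  pose v := y - x; pose w := v - s *: delta_mx 0 j.
  have vi i : `|v ord0 i| <= s.
    rewrite /v !mxE; have [->|/yi/ltW ij] := eqVneq i j.
      by rewrite gtr0_norm.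
    by apply: le_trans ij _; rewrite ger_pMl.
  have nv : `|v| <= s.
    rewrite [leLHS]/Num.Def.normr/= mx_normrE bigmax_le ?ltW// => -[a i] _.
    by rewrite [a]ord1.
  have nw : `|w| <= q * s.
    rewrite [leLHS]/Num.Def.normr/= mx_normrE bigmax_le ?mulr_ge0 ?ltW// => -[a i] _.
    rewrite [a]ord1 /w /v /= !mxE eqxx/=.
    have [->|/yi/ltW ij] := eqVneq i j; last by rewrite mulr0 subr0.
    by rewrite mulr1 subrr normr0 mulr_ge0// ltW.
  have dv : 'd h x v = s * dj x + 'd h x w.
    have wE : v = s *: delta_mx 0 j + w by rewrite /w addrC subrK.
    by rewrite {1}wE linearD linearZ.
  have := hdl v (fun i => le_lt_trans (vi i) (lt_trans sq m1)).
  have -> : v + x = y by rewrite /v subrK.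
  rewrite dv ler_distl => /andP[+ _].
  have := hC w; rewrite ler_norml => /andP[+ _].
  have : e * `|v| <= e * s by rewrite ler_pM2l.
  have : C * `|w| <= C * (q * s) by rewrite ler_pM2l.
  have qs : (C + 1) * q * s < e * s by rewrite ltr_pM2r.
  have es : 2 * e * s = (dj x - r) * s by rewrite mulrCA divff// mulr1.
  have dw : exists z : R, 'd h x w = z by eexists.
  case: dw => z ->; move: yh; rewrite -/q; lra.
move=> [m hm]; set q := m.+1%:R^-1 in hm.
have q0 : 0 < q by rewrite invr_gt0.
have q20 : 0 < q / 2 by rewrite divr_gt0.
have [dl dl0 hdl] := differentiable_cube dh q20.
(* Short enough for the axis point to lie in the cone and for the differentiability error to stay
   within [q / 2]. *)
pose s := Num.min q dl / 2.
have m0 : 0 < Num.min q dl by rewrite lt_min q0.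
have s0 : 0 < s by rewrite divr_gt0.
have sq : s < q.
  have : Num.min q dl <= q by rewrite ge_min lexx.
  by rewrite /s; move: m0; lra.
have sdl : s < dl.
  have : Num.min q dl <= dl by rewrite ge_min lexx orbT.
  by rewrite /s; move: m0; lra.
pose v : 'rV[R]_k := s *: delta_mx 0 j.
have vE i : v ord0 i = if i == j then s else 0.
  by rewrite /v !mxE eqxx/=; case: (i == j); rewrite ?mulr1 ?mulr0.
have vs i : `|v ord0 i| <= s.
  by rewrite vE; case: ifP => _; rewrite ?normr0 ?gtr0_norm// ltW.
have nv : `|v| <= s.
  rewrite [leLHS]/Num.Def.normr/= mx_normrE bigmax_le ?ltW// => -[a i] _.
  by rewrite [a]ord1.
have := hm (v + x); rewrite /steep.
have vxE i : (v + x) ord0 i - x ord0 i = v ord0 i by rewrite mxE addrK.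
rewrite !vxE vE eqxx => nst.
have hv : (r + q) * s <= h (v + x) - h x.
  rewrite leNgt; apply/negP => hlt; apply: nst; split => //.
    by rewrite s0.
  by move=> i ij; rewrite vxE vE (negbTE ij) normr0 mulr_gt0.
have := hdl v (fun i => le_lt_trans (vs i) sdl).
have -> : 'd h x v = s * dj x by rewrite linearZ.
rewrite ler_distl => /andP[_ +].
have : q / 2 * `|v| <= q / 2 * s by rewrite ler_pM2l.
move=> h1 h2; have : (r + q) * s <= (dj x + q / 2) * s by lra.
by rewrite ler_pM2r//; lra.
Qed.

(** Limits of difference quotients would evaluate [h] off [D], where it need not be measurable. A
    union over all [y] of conditions open in the apex avoids this. *)
Lemma measurable_partial D : measurable D -> (forall x, D x -> differentiable h x) ->
  measurable_fun D (dj : _ -> measurableTypeR R).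
Proof.
move=> mD dh; apply: (measurability _ (RGenOInfty.measurableE R)).
move=> _ [_ [r ->] <-].
pose B m : set 'rV[R]_k := [set x | exists y, steep r m.+1%:R^-1 x y].
have -> : D `&` dj @^-1` `]r, +oo[ = \bigcup_m (D `\` (D `&` B m)).
  apply/seteqP; split => [x [Dx]|x [m _ [Dx nB]]] /=.
    rewrite in_itv/= andbT => /(gt_partialP _ (dh _ Dx))[m hm].
    by exists m => //; split => // -[_ [y]]; exact: hm.
  rewrite in_itv/= andbT; split => //; apply/(gt_partialP _ (dh _ Dx)).
  by exists m => y st; apply: nB; split => //; exists y.
apply: bigcupT_measurable => m; apply: measurableD => //.
apply: measurable_rel_open => // x Dx [y st].
have m0 : 0 < m.+1%:R^-1 :> R by rewrite invr_gt0.
have := steep_open m0 (differentiable_continuous (dh _ Dx)) st.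
by apply: filterS => z; exists y.
Qed.

End partial_derivatives.

(** * Gram matrices *)

Section differentials.
Context (R : realType).

Lemma near_eq_differentiable (V W : normedModType R) (g1 g2 : V -> W) (x : V) :
  (\forall y \near x, g1 y = g2 y) -> differentiable g1 x ->
  differentiable g2 x /\ 'd g2 x = 'd g1 x :> (V -> W).
Proof.
move=> e12 d1; have c1 := diff_continuous d1.
have e2 : g2 \o shift x = cst (g2 x) + 'd g1 x +o_ (0 : V) id.
  apply/eqaddoP => e e0; have /eqaddoP/(_ _ e0) := diff_locally d1.
  have : \forall y \near (0 : V), g1 (y + x) = g2 (y + x).
    by move: e12; rewrite (near_shift 0) subr0.
  move=> h0 h1; apply: filterS2 h0 h1 => y /= h.
  by rewrite !fctE /= -(nbhs_singleton e12) h.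
have d2 : 'd g2 x = 'd g1 x :> (V -> W) by apply: diff_unique.
by split; [apply/diff_locallyP; rewrite d2|exact: d2].
Qed.

Lemma near_eq_continuous (S T : topologicalType) (g1 g2 : S -> T) (x : S) :
  (\forall y \near x, g1 y = g2 y) -> {for x, continuous g1} -> {for x, continuous g2}.
Proof.
move=> e12 c1; rewrite /prop_for /continuous_at -(nbhs_singleton e12).
exact: cvg_trans (near_eq_cvg e12) c1.
Qed.

Lemma continuous_sum (T : topologicalType) n (g : 'I_n -> T -> R) (x : T) :
  (forall j, {for x, continuous (g j)}) ->
  {for x, continuous (fun y => \sum_(j < n) g j y)}.
Proof.
move=> cg; rewrite /prop_for /continuous_at.
by apply: cvg_big => [|j _]; [exact: add_continuous|exact: cg].
Qed.

Lemma differentiable_rV (V : normedModType R) n (u : V -> 'rV[R]_n) (x : V) :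
  (forall j, differentiable (fun y => u y ord0 j) x) -> differentiable u x.
Proof.
move=> du; have -> : u = \sum_(j < n) (fun y => u y ord0 j *: delta_mx 0 j).
  apply/funext => y; rewrite fct_sumE [LHS]row_sum_delta.
  by [].
by apply: differentiable_sum => j; exact: differentiableZl.
Qed.

Lemma differentiable_entry (V : normedModType R) n (u : V -> 'rV[R]_n) (x : V) j :
  differentiable u x -> differentiable (fun y => u y ord0 j) x.
Proof.
move=> du; apply: (@differentiable_comp _ _ _ _ u (fun v : 'rV[R]_n => v ord0 j)) => //.
exact: differentiable_coord.
Qed.

Lemma diff_entry (V : normedModType R) n (u : V -> 'rV[R]_n) (x v : V) j :
  differentiable u x -> 'd u x v ord0 j = 'd (fun y => u y ord0 j) x v.
Proof.
move=> du; rewrite -!deriveE//; last exact: differentiable_entry.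
by rewrite derive_mx ?mxE//; exact: diff_derivable.
Qed.

Lemma row_jacobian k n (u : 'rV[R]_k -> 'rV[R]_n) x a :
  differentiable u x -> row a ('J u x) = 'd u x (delta_mx 0 a).
Proof. by move=> du; rewrite rowE -(deriveEjacobian _ du) deriveE. Qed.

Lemma jacobian_comp k m n (u : 'rV[R]_k -> 'rV[R]_m) (t : 'rV[R]_m -> 'rV[R]_n) x :
  differentiable u x -> differentiable t (u x) ->
  'J (t \o u) x = 'J u x *m 'J t (u x).
Proof.
move=> du dt; apply/row_matrixP => a; rewrite row_mul !rowE.
have dtu : differentiable (t \o u) x by exact: differentiable_comp.
rewrite -(deriveEjacobian _ dtu) (deriveE _ dtu) diff_comp//.
by rewrite -(deriveEjacobian _ du) (deriveE _ du) -(deriveEjacobian _ dt) deriveE.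
Qed.

(* Equations between differentials are composed as terms: rewriting would try to
   convert distinct differentials into each other, which does not terminate in
   practice. *)
Lemma near_eq_jacobian k n (u v : 'rV[R]_k -> 'rV[R]_n) x :
  (\forall y \near x, u y = v y) -> differentiable u x ->
  differentiable v x /\ 'J v x = 'J u x.
Proof.
move=> uv du; have [dv e] := near_eq_differentiable uv du.
split; first exact: dv.
apply/row_matrixP => a; apply: (etrans (row_jacobian a dv)).
apply: etrans (esym (row_jacobian a du)).
exact: (congr1 (fun F => F (delta_mx 0 a)) e).
Qed.

(** Tangent vectors being rows, this is the column that a real coordinate contributes to a Jacobian
    matrix. *)
Definition gradient k (h : 'rV[R]_k -> R) (x : 'rV[R]_k) : 'cV[R]_k :=
  \col_i 'd h x (delta_mx 0 i).

Lemma jacobian_row_mx k n (h : 'rV[R]_k -> R) (u : 'rV[R]_k -> 'rV[R]_n) x :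
  differentiable h x -> differentiable u x ->
  'J (fun y => row_mx (h y)%:M (u y) : 'rV[R]_(1 + n)) x =
  row_mx (gradient h x) ('J u x).
Proof.
move=> dh du.
have eh j : (fun y => (row_mx (h y)%:M (u y) : 'rV[R]_(1 + n)) ord0 (lshift n j)) = h.
  by apply/funext => y; rewrite row_mxEl [j]ord1 mxE eqxx mulr1n.
have eu j : (fun y => (row_mx (h y)%:M (u y) : 'rV[R]_(1 + n)) ord0 (rshift 1 j)) =
    (fun y => u y ord0 j).
  by apply/funext => y; rewrite row_mxEr.
have dr : differentiable (fun y => row_mx (h y)%:M (u y) : 'rV[R]_(1 + n)) x.
  apply: differentiable_rV => j; case: (split_ordP j) => i ->.
    by rewrite eh.
  by rewrite eu; exact: differentiable_entry.
apply/matrixP => i j; rewrite [LHS]mxE diff_entry//.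
case: (split_ordP j) => l ->; first by rewrite eh row_mxEl mxE.
by rewrite eu row_mxEr mxE diff_entry.
Qed.

Lemma gradient0_eq k (h : 'rV[R]_k -> R) x : gradient h x = 0 ->
  forall v, 'd h x v = 0.
Proof.
move=> g0 v; rewrite [v]row_sum_delta linear_sum big1// => i _.
rewrite linearZ/=; have /colP/(_ i) := g0; rewrite !mxE => ->.
by rewrite scaler0.
Qed.
End differentials.

Section gram_chart.
Context (R : realType) (n : nat) (M : riemannian R n).
Hypothesis hM : is_riemannian M.

Lemma metric_posdef (i : chart_index M) (p : M) : chart_dom i p ->
  posdef (metric i (chart i p)).
Proof.
move=> ip; split; first exact: Defs.metric_sym.
by move=> v v0; exact: Defs.metric_pos.
Qed.

Context (k : nat) (psi : 'rV[R]_k -> M) (x : 'rV[R]_k).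
Hypothesis psi_continuous : {for x, continuous psi}.
Context (i : chart_index M).
Hypothesis ix : chart_dom i (psi x).
Hypothesis dix : differentiable (chart i \o psi) x.

(** By continuity [psi] stays in the domain of [i] near [x], where [chart j \o psi] factors through
    the smooth transition map; the chain rule applies. *)
Lemma change_chart (j : chart_index M) : chart_dom j (psi x) ->
  differentiable (chart j \o psi) x /\
  'J (chart j \o psi) x =
    'J (chart i \o psi) x *m 'J (chart j \o chart_inv i) (chart i (psi x)).
Proof.
move=> jx.
have dt : differentiable (chart j \o chart_inv i) (chart i (psi x)).
  have [+ _] := transition_smooth hM i j 1%N.
  by apply; exists (psi x).
have [|dj ->] := near_eq_jacobian (v := chart j \o psi) _ (differentiable_comp dix dt); last first.
  by split; [exact: dj|exact: jacobian_comp].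
have : nbhs x (psi @^-1` chart_dom i).
  by apply: psi_continuous; apply: open_nbhs_nbhs; split => //; exact: chart_dom_open.
by apply: filterS => y iy /=; rewrite chartK.
Qed.

Lemma gramE : gram psi x =
  'J (chart i \o psi) x *m metric i (chart i (psi x)) *m ('J (chart i \o psi) x)^T.
Proof.
have [dj eJ] := change_chart (chart_at_dom hM (psi x)).
rewrite /gram /mdiff eJ.
rewrite [in RHS](metric_change hM ix (chart_at_dom hM (psi x))) /=.
by rewrite trmx_mul !mulmxA.
Qed.
End gram_chart.

Section warped_gram.
Context (R : realType) (n : nat) (f : R -> R) (N : riemannian R n).
Hypothesis hN : is_riemannian N.
Local Notation W := (warped_product f N).
Context (k : nat).

(** The warped metric is block diagonal, so the height contributes exactly a rank one term, the
    shape handled by [det_rank1_update]. *)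
Lemma gram_wpair (h : 'rV[R]_k -> R) (psi : 'rV[R]_k -> N) x :
  differentiable h x -> differentiable (chart (chart_at (psi x)) \o psi) x ->
  mdiff (fun y => wpair f (h y) (psi y) : W) x =
    row_mx (gradient h x) (mdiff psi x) /\
  gram (fun y => wpair f (h y) (psi y) : W) x =
    gradient h x *m (gradient h x)^T + f (h x) ^+ 2 *: gram psi x.
Proof.
move=> dh du.
have e : mdiff (fun y => wpair f (h y) (psi y) : W) x =
    row_mx (gradient h x) (mdiff psi x).
  by rewrite /mdiff -(jacobian_row_mx dh du).
split => //; rewrite /gram /= e !row_mxKl !row_mxKr mxE eqxx mulr1n.
rewrite mul_row_block mulmx1 !mulmx0 add0r addr0 tr_row_mx mul_row_col.
by rewrite -scalemxAr -scalemxAl.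
Qed.
End warped_gram.

Section patch.
Context (R : realType) (n : nat) (f : R -> R) (N : riemannian R n).
Hypothesis hN : is_riemannian N.
Local Notation W := (warped_product f N).
Context (k : nat) (b : R) (D : set 'rV[R]_k) (phi : 'rV[R]_k -> W).
Hypothesis D_open : open D.
Hypothesis phi_smooth : smooth_map D phi.
Hypothesis phi_fiber : forall x, D x -> wproj1 (phi x) = b.
Hypothesis phi_immersion : forall x, D x -> row_free (mdiff phi x).

Let psi x : N := wproj2 (phi x).

Lemma wproj2_continuous x : D x -> {for x, continuous psi}.
Proof.
move=> Dx; apply: (@continuous_comp _ _ _ phi (snd : (R * N)%type -> N)).
  exact: phi_smooth.1.
exact: cvg_snd.
Qed.

Let U (i : chart_index N) : set 'rV[R]_k := [set x | D x /\ chart_dom i (psi x)].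

(** Smoothness of [phi] is stated in charts of [W]; the charts of [N] are read off from their last
    [n] coordinates. *)
Let Wchart (i : chart_index N) (x : 'rV[R]_k) : 'rV[R]_(1 + n) :=
  row_mx (phi x).1%:M (chart i (psi x)).

Lemma Wchart_C1 i x : U i x -> differentiable (Wchart i) x /\
  forall v, {for x, continuous (fun y => 'D_v (Wchart i) y)}.
Proof.
move=> [Dx ix]; have [+ +] := phi_smooth.2 i 1%N => d c.
have Ux : (D `&` phi @^-1` chart_dom (i : chart_index W)) x by [].
by split=> [|v]; [exact: d Ux|exact: c Ux].
Qed.

Lemma chart_entry i j : (fun y => chart i (psi y) ord0 j) =
  (fun y => Wchart i y ord0 (rshift 1 j)).
Proof. by apply/funext => y; rewrite row_mxEr. Qed.

Lemma chart_differentiable i x : U i x -> differentiable (chart i \o psi) x.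
Proof.
move=> Ux; apply: differentiable_rV => j.
have -> : (fun y => (chart i \o psi) y ord0 j) = (fun y => Wchart i y ord0 (rshift 1 j)).
  exact: chart_entry.
exact: differentiable_entry (Wchart_C1 Ux).1.
Qed.

Lemma chart_domain_nbhs i x : U i x -> nbhs x (U i).
Proof.
move=> [Dx ix]; apply: filterI.
  exact: open_nbhs_nbhs.
apply: wproj2_continuous => //; apply: open_nbhs_nbhs; split => //.
exact: chart_dom_open.
Qed.

Lemma jacobian_continuous i x a j : U i x ->
  {for x, continuous (fun y => 'J (chart i \o psi) y a j)}.
Proof.
move=> Ux.
have e y : U i y ->
    'J (chart i \o psi) y a j = 'D_(delta_mx 0 a) (Wchart i) y ord0 (rshift 1 j).
  move=> Uy; have dy := chart_differentiable Uy.
  have [wy _] := Wchart_C1 Uy.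
  have ce : (fun z => (chart i \o psi) z ord0 j) = (fun z => Wchart i z ord0 (rshift 1 j)).
    exact: chart_entry.
  rewrite mxE diff_entry// ce (deriveE _ wy).
  exact: esym (diff_entry _ _ wy).
have c : {for x, continuous (fun y => 'D_(delta_mx 0 a) (Wchart i) y ord0 (rshift 1 j))}.
  apply: (@continuous_comp _ _ _ (fun y => 'D_(delta_mx 0 a) (Wchart i) y)
    (fun v : 'rV[R]_(1 + n) => v ord0 (rshift 1 j))).
    exact: (Wchart_C1 Ux).2.
  exact: coord_continuous.
apply: near_eq_continuous c.
by apply: filterS (chart_domain_nbhs Ux) => y Uy; exact: esym (e y Uy).
Qed.

Let G x := gram psi x.

(* [gram] uses the preferred chart at each point; near a given point it can be
   computed in one fixed chart. *)
Lemma gram_continuous x (a c : 'I_k) : D x ->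
  {for x, continuous (fun y => G y a c)}.
Proof.
move=> Dx; set i := chart_at (psi x).
have Ux : U i x by split => //; exact: chart_at_dom.
have e y : U i y -> G y a c = \sum_j (\sum_l 'J (chart i \o psi) y a l *
    metric i (chart i (psi y)) l j) * 'J (chart i \o psi) y c j.
  move=> Uy; have [Dy iy] := Uy.
  rewrite /G (gramE hN (wproj2_continuous Dy) iy (chart_differentiable Uy)).
  by rewrite mxE; apply: eq_bigr => j _; rewrite mxE mxE.
have : {for x, continuous (fun y => \sum_j (\sum_l 'J (chart i \o psi) y a l *
    metric i (chart i (psi y)) l j) * 'J (chart i \o psi) y c j)}.
  have cm : {for x, continuous (fun y => metric i (chart i (psi y)))}.
    apply: (@continuous_comp _ _ _ (chart i \o psi) (metric i)).
      exact: differentiable_continuous (chart_differentiable Ux).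
    by apply: (metric_smooth hN i 0%N); exists (psi x) => //; case: Ux.
  apply: continuous_sum => j.
  apply: (@continuousM R _ (fun y => \sum_l 'J (chart i \o psi) y a l *
    metric i (chart i (psi y)) l j)); last exact: jacobian_continuous.
  apply: continuous_sum => l; apply: (@continuousM R _ (fun y => 'J (chart i \o psi) y a l)).
    exact: jacobian_continuous.
  apply: (@continuous_comp _ _ _ (fun y => metric i (chart i (psi y)))
    (fun A : 'M[R]_n => A l j)) => //.
  exact: coord_continuous.
apply: near_eq_continuous.
by apply: filterS (chart_domain_nbhs Ux) => y Uy; exact: esym (e y Uy).
Qed.

Lemma chart_at_differentiable x : D x -> differentiable (chart (chart_at (psi x)) \o psi) x.
Proof. by move=> Dx; apply: chart_differentiable; split => //; exact: chart_at_dom. Qed.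

Lemma wproj1_near x : D x -> differentiable (fun y => wproj1 (phi y)) x /\
  gradient (fun y => wproj1 (phi y)) x = 0.
Proof.
move=> Dx.
have near_b : \forall y \near x, cst b y = wproj1 (phi y).
  by apply: filterS (open_nbhs_nbhs (conj D_open Dx)) => y Dy; rewrite phi_fiber.
have [d e] := near_eq_differentiable near_b (differentiable_cst b x).
split; first exact: d.
by apply/colP => i; rewrite !mxE e diff_cst.
Qed.

Lemma patch_pair : phi = (fun y => wpair f (wproj1 (phi y)) (psi y)).
Proof. by apply/funext => y; rewrite /wpair /psi /wproj1 /wproj2; case: (phi y). Qed.

(** The height is constant on the patch, so the first column of [mdiff phi] is zero. The immersion
    hypothesis therefore passes to the projection [psi], and its Gram matrix is a positive definite
    pullback. *)
Lemma gram_patch x : D x ->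
  gram phi x = f b ^+ 2 *: G x /\ posdef (G x).
Proof.
move=> Dx; have [d1 g0] := wproj1_near Dx.
have [eJ eG] := gram_wpair f d1 (chart_at_differentiable Dx).
split; first by rewrite patch_pair eG g0 mul0mx add0r phi_fiber.
apply: posdef_congr; last first.
  apply: metric_posdef => //; exact: chart_at_dom.
have := phi_immersion Dx; rewrite patch_pair eJ g0 => /row_free_inj fr.
rewrite -kermx_eq0; apply/rowV0P => v /sub_kermxP v0.
apply: (fr 1%N v 0); rewrite mul_mx_row mulmx0 v0 mul0mx.
by rewrite row_mx0.
Qed.

End patch.

(** * Gram matrices of rooms and integration over rooms *)

Section room_gram.
Context (R : realType) (n : nat) (f : R -> R) (N : riemannian R n).
Hypothesis hN : is_riemannian N.
Local Notation W := (warped_product f N).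
Context (k : nat).

Lemma diff_coordinate m (z v : 'rV[R]_m) j :
  'd (fun y : 'rV[R]_m => y ord0 j) z v = v ord0 j.
Proof.
have di := is_diff_id z.
have e := @diff_entry R _ m id z v j (@ex_diff _ _ _ _ _ _ _ di).
by apply: (etrans (esym e)); rewrite (@diff_val _ _ _ _ _ _ _ di).
Qed.

Lemma gradient_lsubmx (z : 'rV[R]_(1 + k)) :
  differentiable (fun y : 'rV[R]_(1 + k) => lsubmx y ord0 ord0) z /\
  gradient (fun y => lsubmx y ord0 ord0) z = col_mx 1%:M 0.
Proof.
have -> : (fun y : 'rV[R]_(1 + k) => lsubmx y ord0 ord0) =
    (fun y : 'rV[R]_(1 + k) => y ord0 (lshift k ord0)).
  by apply/funext => y; rewrite mxE.
split; first exact: differentiable_coord.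
apply/colP => i; rewrite mxE diff_coordinate mxE /=.
case: (split_ordP i) => j ->; last by rewrite col_mxEd mxE eq_lrshift.
by rewrite col_mxEu mxE [j]ord1 !eqxx.
Qed.

Lemma jacobian_rsubmx (z : 'rV[R]_(1 + k)) :
  'J (rsubmx : 'rV[R]_(1 + k) -> 'rV[R]_k) z = col_mx 0 1%:M.
Proof.
have dr : differentiable (rsubmx : 'rV[R]_(1 + k) -> 'rV[R]_k) z.
  exact: differentiable_rsubmx.
apply/matrixP => i j; rewrite mxE diff_entry//.
have -> : (fun y : 'rV[R]_(1 + k) => rsubmx y ord0 j) =
    (fun y : 'rV[R]_(1 + k) => y ord0 (rshift 1 j)).
  by apply/funext => y; rewrite mxE.
rewrite diff_coordinate mxE /=.
case: (split_ordP i) => l ->; first by rewrite col_mxEu mxE eq_rlshift.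
by rewrite col_mxEd mxE (inj_eq (@rshift_inj _ _)) eq_sym.
Qed.

Lemma gram_room (psi : 'rV[R]_k -> N) (z : 'rV[R]_(1 + k)) :
  differentiable (chart (chart_at (psi (rsubmx z))) \o psi) (rsubmx z) ->
  gram (fun y : 'rV[R]_(1 + k) => wpair f (lsubmx y ord0 ord0) (psi (rsubmx y)) : W) z =
  block_mx 1%:M 0 0 (f (lsubmx z ord0 ord0) ^+ 2 *: gram psi (rsubmx z)).
Proof.
move=> dpsi; have [dl gl] := gradient_lsubmx z.
have dr : differentiable (rsubmx : 'rV[R]_(1 + k) -> 'rV[R]_k) z.
  exact: differentiable_rsubmx.
pose psir (y : 'rV[R]_(1 + k)) := psi (rsubmx y).
have dc : differentiable (chart (chart_at (psir z)) \o psir) z.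
  exact: (differentiable_comp dr dpsi).
have [_ eG] := gram_wpair f dl dc.
apply: (etrans eG); rewrite gl {eG}.
have -> : gram psir z = block_mx 0 0 0 (gram psi (rsubmx z)).
  have eJ : mdiff psir z = col_mx 0 (mdiff psi (rsubmx z)).
    apply: (etrans (jacobian_comp dr dpsi)).
    by rewrite jacobian_rsubmx mul_col_mx mul0mx mul1mx.
  rewrite {1}/gram eJ mul_col_mx mul0mx tr_col_mx trmx0 mul_col_row.
  by rewrite !mul0mx mulmx0.
rewrite tr_col_mx trmx0 trmx1 mul_col_row !mul0mx mulmx0 mulmx1.
by rewrite scale_block_mx !scaler0 add_block_mx !addr0 !add0r.
Qed.

End room_gram.

Section room_integral.
Context (R : realType) (k : nat).
Local Notation mu := (lebesgue_rV R k).
Local Notation time z := (lsubmx z ord0 ord0).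

Lemma measurable_time : measurable_fun setT
  (fun z : 'rV[R]_(1 + k) => time z : measurableTypeR R).
Proof.
rewrite (_ : (fun z => _) = fun z : 'rV[R]_(1 + k) => z ord0 (lshift k ord0) : measurableTypeR R).
  exact: measurable_rV_coord.
by apply/funext => z; rewrite mxE.
Qed.

Lemma measurable_rsubmx : measurable_fun setT (rsubmx : 'rV[R]_(1 + k) -> 'rV[R]_k).
Proof.
apply: measurable_to_rV => i.
rewrite (_ : (fun t => _) = fun x : 'rV[R]_(1 + k) => x ord0 (rshift 1 i) : measurableTypeR R).
  exact: measurable_rV_coord.
by apply/funext => x /=; rewrite mxE.
Qed.

Lemma measurable_preimage_rsubmx (A : set 'rV[R]_k) : measurable A ->
  measurable ((rsubmx : 'rV[R]_(1 + k) -> 'rV[R]_k) @^-1` A).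
Proof. by move=> mA; rewrite -[X in measurable X]setTI; exact: measurable_rsubmx. Qed.

(** The cylinder is a line times a null set, and infinity times zero is zero for extended reals. *)
Lemma null_preimage_rsubmx (A : set 'rV[R]_k) : measurable A -> mu A = 0%E ->
  lebesgue_rV R (1 + k) ((rsubmx : 'rV[R]_(1 + k) -> 'rV[R]_k) @^-1` A) = 0%E.
Proof.
move=> mA A0.
have -> : lebesgue_rV R (1 + k) ((rsubmx : 'rV[R]_(1 + k) -> 'rV[R]_k) @^-1` A) =
    (lebesgue_measure \x mu)%E (setT `*` A).
  rewrite /= /lebesgue_rV_step /pushforward; congr (_ _).
  by apply/seteqP; split => -[t y] /=; rewrite /consrV row_mxKr => // -[].
by rewrite product_measure1E// [X in (_ * X)%E]A0 mule0.
Qed.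

Lemma rsubmx_comp_measurable (D : set 'rV[R]_k) (h : 'rV[R]_k -> R) : measurable D ->
  measurable_fun D (h : _ -> measurableTypeR R) ->
  measurable_fun ((rsubmx : 'rV[R]_(1 + k) -> 'rV[R]_k) @^-1` D)
    (fun z => h (rsubmx z) : measurableTypeR R).
Proof.
move=> mD mh; apply: (measurable_comp (F := D)) => //.
  by move=> _ [z Dz <-].
by apply: measurable_funTS; exact: measurable_rsubmx.
Qed.

(* [h] need not be measurable on [A], so the room is first cut down to the part over
   [D `\` A], which is a Borel set. *)
Lemma room_integral (D A : set 'rV[R]_k) (h rho : 'rV[R]_k -> R) (g V : R -> R) (b : R)
    (Phi : 'rV[R]_(1 + k) -> \bar R) :
  measurable A -> mu A = 0%E -> measurable (D `\` A) ->
  measurable_fun (D `\` A) (h : _ -> measurableTypeR R) ->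
  measurable_fun (D `\` A) (rho : _ -> measurableTypeR R) ->
  (forall x, D x -> 0 <= rho x) -> continuous g -> (forall t, 0 <= g t) ->
  (forall x, D x -> b <= h x) ->
  (forall t, b <= t -> (\int[lebesgue_measure]_(s in `[b, t]) (g s)%:E = (V t)%:E)%E) ->
  (forall z, 0 <= Phi z)%E ->
  (forall z, D (rsubmx z) -> Phi z = (rho (rsubmx z) * g (time z))%:E) ->
  (\int[lebesgue_rV R (1 + k)]_(z in
      [set z | D (rsubmx z) /\ (b <= time z <= h (rsubmx z))%R]) Phi z =
   \int[mu]_(x in D `\` A) (rho x * V (h x))%:E)%E.
Proof.
move=> mA A0 mDA mh mrho rho0 cg g0 bh VE Phi0 PhiE.
have mA' := measurable_preimage_rsubmx mA.
rewrite (ge0_integral_setD_null _ mA' (null_preimage_rsubmx mA A0))//.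
set E := _ `\` _.
have EE : E = (rsubmx : 'rV[R]_(1 + k) -> 'rV[R]_k) @^-1` (D `\` A) `&`
    (fun z : 'rV[R]_(1 + k) => (b <= time z) && (time z <= h (rsubmx z))) @^-1` [set true].
  by apply/seteqP; split => z /= [[Dz ?] ?]; split.
have mg : measurable_fun setT (g : measurableTypeR R -> measurableTypeR R).
  exact: continuous_measurable_fun.
have mD' := measurable_preimage_rsubmx mDA.
have mh' := rsubmx_comp_measurable mDA mh.
have mrho' := rsubmx_comp_measurable mDA mrho.
have mE : measurable E.
  rewrite EE; apply: measurable_and => //.
    by apply: measurable_fun_ler => //; apply: measurable_funTS; exact: measurable_time.
  by apply: measurable_fun_ler => //; apply: measurable_funTS; exact: measurable_time.
pose G (z : 'rV[R]_(1 + k)) := (rho (rsubmx z) * g (time z))%:E.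
have mG : measurable_fun E G.
  apply/measurable_EFinP; apply: measurable_funM.
    by apply: measurable_funS mrho' => //; rewrite EE => z [].
  apply: (measurableT_comp mg).
  by apply: measurable_funTS; exact: measurable_time.
rewrite (eq_integral G) => [|z]; last by rewrite inE => -[[Dz _] _]; rewrite PhiE.
rewrite [LHS](ge0_integral_pushforward (@measurable_consrV R k))//; last first.
  by move=> z; rewrite inE => -[[Dz _] _]; rewrite lee_fin mulr_ge0// rho0.
rewrite integral_mkcond.
have mcE : measurable (@consrV R k @^-1` E).
  by rewrite -[X in measurable X]setTI; exact: measurable_consrV.
have mF : measurable_fun setT ((G \o @consrV R k) \_ (@consrV R k @^-1` E)).
  apply: (measurable_restrictT _ mcE).1.
  have sub : @consrV R k @` (@consrV R k @^-1` E) `<=` E by move=> _ [p Ep <-].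
  have mc : measurable_fun (@consrV R k @^-1` E) (@consrV R k).
    by apply: measurable_funTS; exact: measurable_consrV.
  exact: (measurable_comp mE sub mG mc).
have F0 p : (0 <= ((G \o @consrV R k) \_ (@consrV R k @^-1` E)) p)%E.
  rewrite patchE; case: ifPn => //; rewrite inE => -[[Dz _] _].
  by rewrite lee_fin mulr_ge0// rho0.
(* Tonelli exchanges the order so that the height is integrated first. Over [x] the section of the
   room is the segment from [b] to [h x], and its integral is [V (h x)]. *)
rewrite fubini_tonelli1// fubini_tonelli// [RHS]integral_mkcond.
apply: eq_integral => x _; rewrite /fubini_G patchE; case: ifPn.
  rewrite inE => -[Dx nAx].
  rewrite EFinM -VE ?bh// -ge0_integralZl//; last 3 first.
  - by apply/measurable_EFinP/measurable_funTS.
  - by move=> t _; rewrite lee_fin.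
  - by rewrite lee_fin rho0.
  rewrite [RHS]integral_mkcond; apply: eq_integral => t _; rewrite !patchE.
  have -> : ((t, x) \in @consrV R k @^-1` E) = (t \in `[b, h x]%classic).
    apply/idP/idP; rewrite !inE /= /E /= /consrV row_mxKl row_mxKr mxE eqxx mulr1n in_itv/=.
      by move=> [[_ ?] _].
    by move=> ?; split.
  by case: ifP => // _; rewrite /G /= /consrV row_mxKl row_mxKr mxE eqxx mulr1n EFinM.
rewrite notin_setE => nD; apply: integral0_eq => t _; rewrite patchE; case: ifPn => //.
by rewrite inE /= /E /= /consrV row_mxKr => -[[Dx _] nA]; case: nD.
Qed.

End room_integral.

Lemma measurable_fun_det (R : realType) d (T : measurableType d) k (D : set T)
    (M : T -> 'M[R]_k) :
  (forall a c, measurable_fun D (fun x => M x a c : measurableTypeR R)) ->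
  measurable_fun D (fun x => \det (M x) : measurableTypeR R).
Proof.
move=> mM; rewrite /determinant.
apply: measurable_sum => s; apply: measurable_funM; first exact: measurable_cst.
by apply: measurable_prod => i _; exact: mM.
Qed.

Lemma sqrt_det_scale (R : realType) k (a : R) (G : 'M[R]_k) : 0 <= a ->
  Num.sqrt (\det (a ^+ 2 *: G)) = a ^+ k * Num.sqrt (\det G).
Proof.
move=> a0; rewrite detZ exprAC sqrtrM ?sqr_ge0// sqrtr_sqr ger0_norm//.
exact: exprn_ge0.
Qed.

(** * Volumes of floors, ceilings and rooms *)

Section patch_volumes.
Context (R : realType) (n : nat) (f : R -> R) (N : riemannian R n).
Hypothesis hN : is_riemannian N.
Hypothesis f_gt0 : forall t, 0 < f t.
Hypothesis f_continuous : continuous f.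
Local Notation W := (warped_product f N).
Context (k : nat) (b : R) (D : set 'rV[R]_k) (phi : 'rV[R]_k -> W).
Hypothesis D_open : open D.
Hypothesis phi_smooth : smooth_map D phi.
Hypothesis phi_fiber : forall x, D x -> wproj1 (phi x) = b.
Hypothesis phi_immersion : forall x, D x -> row_free (mdiff phi x).
Context (A : set 'rV[R]_k).
Hypothesis mA : measurable A.
Hypothesis A0 : lebesgue_rV R k A = 0%E.

Let psi x : N := wproj2 (phi x).
Let G x := gram psi x.

(** The [rho] of the overview: the volume density of the projection of the floor to [N]. *)
Definition density x := Num.sqrt (\det (G x)).

Lemma measurable_patchD : measurable (D `\` A).
Proof. by apply: measurableD => //; exact: open_measurable_rV. Qed.

Lemma gram_posdef x : D x -> posdef (G x).
Proof. by move=> Dx; have [] := gram_patch hN D_open phi_smooth phi_fiber phi_immersion Dx. Qed.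

Lemma density_gt0 x : D x -> 0 < density x.
Proof. by move=> Dx; rewrite sqrtr_gt0; apply: posdef_det_gt0; exact: gram_posdef. Qed.

Lemma measurable_gram a c :
  measurable_fun (D `\` A) (fun x => G x a c : measurableTypeR R).
Proof.
apply: measurable_fun_continuous; first exact: measurable_patchD.
move=> x [Dx _].
exact: (gram_continuous hN D_open phi_smooth).
Qed.

Lemma measurable_sqrt_det (M : 'rV[R]_k -> 'M[R]_k) :
  (forall a c, measurable_fun (D `\` A) (fun x => M x a c : measurableTypeR R)) ->
  measurable_fun (D `\` A) (fun x => Num.sqrt (\det (M x)) : measurableTypeR R).
Proof.
move=> mM.
have ms : measurable_fun setT (Num.sqrt : measurableTypeR R -> measurableTypeR R).
  by apply: continuous_measurable_fun; exact: sqrt_continuous.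
apply: (measurableT_comp ms); exact: measurable_fun_det.
Qed.

Lemma measurable_density : measurable_fun (D `\` A) (density : _ -> measurableTypeR R).
Proof. exact: measurable_sqrt_det measurable_gram. Qed.

Lemma param_volume_floor :
  param_volume D phi = (\int[lebesgue_rV R k]_(x in D `\` A) (f b ^+ k * density x)%:E)%E.
Proof.
rewrite /param_volume (ge0_integral_setD_null _ mA A0); last first.
  by move=> x; rewrite lee_fin sqrtr_ge0.
apply: eq_integral => x; rewrite inE => -[Dx _].
have [-> _] := gram_patch hN D_open phi_smooth phi_fiber phi_immersion Dx.
by rewrite sqrt_det_scale// ltW.
Qed.

Context (h : 'rV[R]_k -> R).
Hypothesis h_differentiable : forall x, (D `\` A) x -> differentiable h x.

Definition ceiling_density x :=
  Num.sqrt (\det (gradient h x *m (gradient h x)^T + f (h x) ^+ 2 *: G x)).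

Lemma param_volume_ceiling :
  param_volume D (fun x => wpair f (h x) (psi x)) =
  (\int[lebesgue_rV R k]_(x in D `\` A) (ceiling_density x)%:E)%E.
Proof.
rewrite /param_volume (ge0_integral_setD_null _ mA A0); last first.
  by move=> x; rewrite lee_fin sqrtr_ge0.
apply: eq_integral => x; rewrite inE => Dx; have [Dx' _] := Dx.
have dc := chart_at_differentiable hN phi_smooth Dx'.
by have [_ ->] := gram_wpair f (h_differentiable Dx) dc.
Qed.

Let fG_posdef x : D x -> posdef (f (h x) ^+ 2 *: G x).
Proof. by move=> Dx; apply: posdefZ; [rewrite exprn_gt0|exact: gram_posdef]. Qed.

Lemma ceiling_density_ge x : D x -> density x * f (h x) ^+ k <= ceiling_density x.
Proof.
move=> Dx; rewrite mulrC -sqrt_det_scale ?(ltW (f_gt0 _))// /ceiling_density; apply: ler_wsqrtr.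
exact: le_det_rank1_update (fG_posdef Dx).
Qed.

(** Equality of the square roots gives equality of the determinants, and the equality case of the
    rank one update makes the gradient vanish. *)
Lemma ceiling_density_eq x : D x ->
  density x * f (h x) ^+ k = ceiling_density x <-> forall v, 'd h x v = 0.
Proof.
move=> Dx; rewrite mulrC -sqrt_det_scale ?(ltW (f_gt0 _))//; split => [e|d0]; last first.
  suff g0 : gradient h x = 0 by rewrite /ceiling_density g0 mul0mx add0r.
  by apply/colP => i; rewrite !mxE d0.
have d0 := posdef_det_gt0 (fG_posdef Dx).
have d1 := le_det_rank1_update (gradient h x) (fG_posdef Dx).
apply: gradient0_eq; apply: (det_rank1_update_eq (fG_posdef Dx)).
move/eqP: e; rewrite eqr_sqrt ?ltW//; first by move/eqP/esym.
exact: lt_le_trans d0 d1.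
Qed.

Lemma measurable_ceiling_density :
  measurable_fun (D `\` A) (ceiling_density : _ -> measurableTypeR R).
Proof.
have mDA := measurable_patchD.
have mh : measurable_fun (D `\` A) (h : _ -> measurableTypeR R).
  apply: measurable_fun_continuous => // x /h_differentiable.
  exact: differentiable_continuous.
have mf : measurable_fun setT (f : measurableTypeR R -> measurableTypeR R).
  exact: continuous_measurable_fun.
apply: measurable_sqrt_det => a c.
have mg i : measurable_fun (D `\` A) (fun x => gradient h x i ord0 : measurableTypeR R).
  have := measurable_partial i mDA h_differentiable.
  by congr measurable_fun; apply/funext => x; rewrite mxE.
rewrite (_ : (fun x => _) = (fun x => gradient h x a ord0 * gradient h x c ord0 +
    f (h x) ^+ 2 * G x a c)); last first.
  apply/funext => x; rewrite [LHS]mxE; congr (_ + _); last by rewrite [LHS]mxE.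
  by rewrite [LHS]mxE big_ord1; congr (_ * _); rewrite [LHS]mxE.
apply: measurable_funD; first by apply: measurable_funM; exact: mg.
apply: measurable_funM; last exact: measurable_gram.
by apply: measurable_funX; exact: (measurableT_comp mf mh).
Qed.

Lemma param_volume_room (V : R -> R) :
  (forall x, D x -> b <= h x) ->
  (forall t, b <= t ->
    (\int[lebesgue_measure]_(s in `[b, t]) (f s ^+ k)%:E = (V t)%:E)%E) ->
  param_volume [set z : 'rV[R]_(1 + k) | D (rsubmx z) /\
      b <= lsubmx z ord0 ord0 <= h (rsubmx z)]
    (fun z => wpair f (lsubmx z ord0 ord0) (psi (rsubmx z))) =
  (\int[lebesgue_rV R k]_(x in D `\` A) (density x * V (h x))%:E)%E.
Proof.
move=> bh VE; apply: (@room_integral R k D A h density (fun t => f t ^+ k) V b) => //.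
- exact: measurable_patchD.
- apply: measurable_fun_continuous; first exact: measurable_patchD.
  by move=> x /h_differentiable; exact: differentiable_continuous.
- exact: measurable_density.
- by move=> x /density_gt0/ltW.
- rewrite -exprfctE => t; elim: (k) => [|j IH]; first by rewrite expr0; exact: cst_continuous.
  by rewrite exprS; apply: continuousM => //; exact: f_continuous.
- by move=> t; rewrite exprn_ge0// ltW.
- move=> z Dz.
  have dc := chart_at_differentiable hN phi_smooth Dz.
  rewrite (gram_room f dc) det_ublock det1 mul1r sqrt_det_scale ?(ltW (f_gt0 _))//.
  by rewrite mulrC.
Qed.

End patch_volumes.

(** * Comparison with the constant height graph *)

Section comparison.
Context d (T : measurableType d) (R : realType) (mu : {measure set T -> \bar R}).
Context (D : nat -> set T) (rho h cd : nat -> T -> R).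
Context (f u1 V : R -> R) (k : nat) (b c : R).
Hypothesis mD : forall i, measurable (D i).
Hypothesis arho : admissible D rho.
Hypothesis rho_gt0 : forall i x, D i x -> 0 < rho i x.
Hypothesis mh : forall i, measurable_fun (D i) (h i : _ -> measurableTypeR R).
Hypothesis bh : forall i x, D i x -> b <= h i x.
Hypothesis acd : admissible D cd.
Hypothesis cd_ge : forall i x, D i x -> rho i x * f (h i x) ^+ k <= cd i x.
Hypothesis f_gt0 : forall t, 0 < f t.
Hypothesis fP : forall t : R, is_derive t 1 f (f t * u1 t).
Hypothesis u1_le : forall s t, s <= t -> u1 s <= u1 t.
Hypothesis bc : b <= c.
Hypothesis VP : forall t : R, b <= t -> is_derive t 1 V (f t ^+ k).
Hypothesis Vb : V b = 0.
Hypothesis rho_fin : (sumint mu D rho < +oo)%E.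
Hypothesis rooms : sumint mu D (fun i x => rho i x * V (h i x)) =
  sumint mu D (fun i x => rho i x * V c).

Local Notation tot := (sumint mu D).
Local Notation adm := (admissible D).
Local Notation e := (calib f u1 k c V).

Lemma antiderivative_incr s t : b <= s -> s < t -> V s < V t.
Proof.
move=> bs st; apply: (@is_derive_incr _ V (fun t => f t ^+ k)) => // x xI.
  by apply: VP; move: xI; lra.
by rewrite exprn_gt0.
Qed.

Lemma antiderivative_le s t : b <= s -> s <= t -> V s <= V t.
Proof. by move=> bs; rewrite le_eqVlt => /predU1P[->//|/(antiderivative_incr bs)/ltW]. Qed.

Lemma antiderivative_ge0 t : b <= t -> 0 <= V t.
Proof. by move=> bt; rewrite -Vb antiderivative_le. Qed.

Let mfh i : measurable_fun (D i) (fun x => f (h i x) ^+ k : measurableTypeR R).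
Proof.
apply: measurable_funX.
have mf : measurable_fun setT (f : measurableTypeR R -> measurableTypeR R).
  by apply: continuous_measurable_fun => t; apply: is_derive_continuous (fP t).
exact: (measurableT_comp mf (@mh i)).
Qed.

Let mVh i : measurable_fun (D i) (fun x => V (h i x) : measurableTypeR R).
Proof.
(* [V] is known to be monotone only from [b] on; precomposing with [Num.max b] makes it monotone
   everywhere. *)
have mV : measurable_fun setT ((fun t => V (Num.max b t)) : measurableTypeR R -> measurableTypeR R).
  apply: nondecreasing_measurable => // s t st; apply: antiderivative_le.
    by rewrite le_max lexx.
  by rewrite ge_max !le_max lexx st orbT.
apply: (eq_measurable_fun (fun x => V (Num.max b (h i x)))).
  by move=> x; rewrite inE => /bh bx; rewrite max_r.
exact: (measurableT_comp mV (@mh i)).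
Qed.

Let aA : adm (fun i x => rho i x * f (h i x) ^+ k).
Proof.
apply: admissibleM => // i; split; first exact: mfh.
by move=> x _; rewrite exprn_ge0// ltW.
Qed.

Let aB : adm (fun i x => rho i x * V (h i x)).
Proof.
apply: admissibleM => // i; split; first exact: mVh.
by move=> x Dx; rewrite antiderivative_ge0// bh.
Qed.

Let ac : adm (fun i x => rho i x * V c).
Proof.
apply: admissibleM => // i; split; first exact: measurable_cst.
by move=> x Dx; rewrite antiderivative_ge0.
Qed.

Let aE : adm (fun i x => rho i x * e (h i x)).
Proof.
apply: admissibleM => // i; split; last first.
  by move=> x Dx; apply: (calib_ge0 f_gt0 fP u1_le bc VP); exact: bh.
apply: measurable_funB.
  by apply: measurable_funB; [exact: mfh|exact: measurable_cst].
apply: measurable_funM; first exact: measurable_cst.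
by apply: measurable_funB; [exact: mVh|exact: measurable_cst].
Qed.

Let rooms_fin : tot (fun i x => rho i x * V c) = ((V c)%:E * tot rho)%E.
Proof.
apply: etrans (sumintZ mu mD (antiderivative_ge0 bc) arho).
by apply: eq_sumint => i x _; rewrite mulrC.
Qed.

Lemma sumint_graph :
  tot (fun i x => rho i x * f (h i x) ^+ k) =
  ((f c ^+ k)%:E * tot rho + tot (fun i x => rho i x * e (h i x))%R)%E.
Proof.
apply: (sumint_calibration (B := fun i x => rho i x * V (h i x)) (q := V c)
  (m := k%:R * u1 c) mD) => //.
- by rewrite exprn_ge0// ltW.
- exact: antiderivative_ge0.
- by move=> i x _; rewrite /calib; ring.
- by rewrite rooms rooms_fin.
Qed.

Lemma sumint_constant_le : ((f c ^+ k)%:E * tot rho <= tot cd)%E.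
Proof.
apply: (@le_trans _ _ (tot (fun i x => rho i x * f (h i x) ^+ k))).
  by rewrite sumint_graph leeDl// sumint_ge0.
exact: le_sumint.
Qed.

(** The untilted volume, the total of [rho * f(h)^k], lies between the two sides. Equality splits
    into one condition for the tilt and one for the calibration, both volumes being finite. *)
Lemma sumint_constant_eq : ((f c ^+ k)%:E * tot rho)%E = tot cd <->
  forall i, {ae mu, forall x, D i x ->
    rho i x * f (h i x) ^+ k = cd i x /\ e (h i x) = 0}.
Proof.
have frho : ((f c ^+ k)%:E * tot rho)%E \is a fin_num.
  by rewrite fin_numM// sumint_fin_num.
split=> [eq i|eq].
  have E0 : tot (fun i x => rho i x * e (h i x)) = 0%E.
    apply/le_anti; rewrite sumint_ge0// andbT.
    by rewrite -(leeD2lE _ _ frho) adde0 -sumint_graph eq; exact: le_sumint.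
  have AE : tot (fun i x => rho i x * f (h i x) ^+ k) = tot cd.
    by rewrite sumint_graph E0 adde0.
  have Afin : (tot (fun i x => rho i x * f (h i x) ^+ k)%R < +oo)%E.
    by rewrite AE -eq ltey_eq frho.
  have h1 := sumint_le_eq mD aA acd cd_ge AE Afin i.
  have h2 := sumint_eq0 mD aE E0 i.
  apply: filterS2 h1 h2 => x h1 h2 Dx; split; first exact: h1.
  by move/eqP: (h2 Dx); rewrite mulf_eq0 gt_eqF ?rho_gt0//= => /eqP.
have <- : tot (fun i x => rho i x * f (h i x) ^+ k) = tot cd.
  by apply: ae_eq_sumint => // i; apply: filterS (eq i) => x /[apply] -[].
rewrite sumint_graph (_ : tot (fun i x => rho i x * e (h i x)) = 0%E) ?adde0//.
rewrite (ae_eq_sumint (v := fun i x => 0 * rho i x) mD) //.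
- by rewrite sumintZ// mul0e.
- exact: admissibleZ.
- by move=> i; apply: filterS (eq i) => x /[apply] -[_ ->]; rewrite mulr0 mul0r.
Qed.

(** If [h] stays on one side of [c], then [V c] and [V (h)] are ordered almost everywhere and have
    the same finite weighted total, so they agree; [V] is strictly increasing from [b] on. *)
Lemma constant_of_one_sided :
  (forall i, {ae mu, forall x, D i x -> c <= h i x}) \/
  (forall i, {ae mu, forall x, D i x -> h i x <= c}) ->
  forall i, {ae mu, forall x, D i x -> h i x = c}.
Proof.
move=> side i.
have fin : (tot (fun i x => rho i x * V c)%R < +oo)%E.
  by rewrite rooms_fin ltey_eq fin_numM// sumint_fin_num.
have : {ae mu, forall x, D i x -> rho i x * V c = rho i x * V (h i x)}.
  case: side => side.
    have le j : {ae mu, forall x, D j x -> rho j x * V c <= rho j x * V (h j x)}.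
      apply: filterS (side j) => x ch Dx.
      by rewrite ler_wpM2l ?(ltW (rho_gt0 Dx))// antiderivative_le ?ch.
    exact: (sumint_ae_le_eq mD ac aB le (esym rooms) fin i).
  have fin' : (tot (fun i x => rho i x * V (h i x))%R < +oo)%E by rewrite rooms.
  have le j : {ae mu, forall x, D j x -> rho j x * V (h j x) <= rho j x * V c}.
    apply: filterS (side j) => x hc Dx.
    by rewrite ler_wpM2l ?(ltW (rho_gt0 Dx))// antiderivative_le ?bh ?hc.
  have := sumint_ae_le_eq mD aB ac le rooms fin' i.
  by apply: filterS => x H Dx; rewrite H.
apply: filterS => x H Dx.
have /mulfI VE := lt0r_neq0 (rho_gt0 Dx); have {}VE := VE _ _ (H Dx).
have bx := bh Dx.
case: (ltgtP (h i x) c) => [lt|lt|//].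
  by have := antiderivative_incr bx lt; rewrite VE ltxx.
by have := antiderivative_incr bc lt; rewrite VE ltxx.
Qed.

End comparison.

(** * Locally constant heights and the proof of the theorem *)

Lemma ae_diff0_locally_constant (R : realType) k (D U : set 'rV[R]_k) (h : 'rV[R]_k -> R) :
  {ae lebesgue_rV R k, forall x, D x -> forall v, 'd h x v = 0} ->
  open U -> U `<=` D -> Ck_on 1 U h ->
  forall x, U x -> \forall y \near x, h y = h x.
Proof.
move=> [A [mA A0 hA]] oU UD [dh ch].
have d0 x v : U x -> 'd h x v = 0.
  move=> Ux; apply: contrapT => n0.
  have n0' : 'D_v h x != 0 by apply/eqP; rewrite deriveE//; exact: dh.
  have h1 : nbhs x [set y | 'D_v h y != 0].
    exact: (cvgr_neq0 _ (ch v x Ux) n0').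
  have h2 : nbhs x U by apply: open_nbhs_nbhs.
  have /nbhs_cubeP[e e0 xe] : nbhs x ([set y | 'D_v h y != 0] `&` U) by exact: filterI.
  (* A nonzero derivative at [x] would persist on a cube by continuity, and the null exceptional set
     would contain that cube. *)
  have cA : cube x e `<=` A.
    move=> y /xe[y1 y2]; apply: hA => /= H; move/eqP: y1; apply.
    by rewrite deriveE ?H//; [exact: UD|exact: dh].
  have := lebesgue_cube_gt0 x e0; rewrite lt_neqAle => /andP[/eqP + _]; apply.
  apply/esym; apply: (subset_measure0 _ _ cA A0) => //; exact: measurable_cube.
move=> x Ux.
have /nbhs_cubeP[e e0 xe] : nbhs x U by apply: open_nbhs_nbhs.
apply/nbhs_cubeP; exists e => // y yx.
(* The segment from [x] to [y] stays in the cube, and [h] has zero derivative along it. *)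
pose l (t : R) : 'rV[R]_k := t *: (y - x) + x.
have dl t : differentiable l t.
  by apply: differentiableD => //; exact: differentiableZl.
have lU t : 0 <= t <= 1 -> U (l t).
  move=> /andP[t0 t1]; apply: xe => j; rewrite /l !mxE addrK normrM ger0_norm//.
  by apply: le_lt_trans (yx j); rewrite ler_piMl.
have dhl (t : R) : 0 <= t <= 1 -> is_derive t 1 (h \o l) 0.
  move=> /lU Ut; have dd : differentiable (h \o l) t.
    by apply: differentiable_comp => //; exact: dh.
  split; first exact: diff_derivable.
  by rewrite deriveE// diff_comp//; [exact: d0|exact: dh].
have := is_derive_eq_cst ler01 dhl (fun _ _ => erefl).
by rewrite /= /l scale0r add0r scale1r subrK => ->.
Qed.

Lemma ae_setD d (T : measurableType d) (R : realType) (mu : {measure set T -> \bar R})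
    (D A : set T) (Q : T -> Prop) : measurable A -> mu A = 0%E ->
  {ae mu, forall x, (D `\` A) x -> Q x} -> {ae mu, forall x, D x -> Q x}.
Proof.
move=> mA A0 [B [mB B0 hB]].
exists (A `|` B); split; first exact: measurableU.
  by rewrite measureU0.
move=> x /= nQ; have [Ax|nAx] := pselect (A x); [by left|right].
by apply: hB => /= H; apply: nQ => Dx; exact: H.
Qed.

Theorem theorem3p1 (R : realType) (n k : nat) (N : riemannian R n)
    (f : R -> R) (b : R) (F : set (warped_product f N))
    (P : patches (warped_product f N) k) (g : N -> R) (H : R) :
  is_riemannian N ->
  (forall t, 0 < f t) -> smooth_on setT f -> log_convex f ->
  complete_riemannian (warped_product f N) ->
  (0 < k)%N ->
  F `<=` fiber b -> piecewise_smooth F P -> (volume P < +oo)%E ->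
  (forall p, F p -> b <= g (wproj2 p)) -> ae_differentiable P g ->
  0 <= H ->
  volume (room_patches P b (cst (b + H))) = volume (room_patches P b g) ->
  let S := ceiling_patches P (cst (b + H)) in
  let C := ceiling_patches P g in
  (volume S <= volume C)%E /\
  (volume S = volume C <->
   piecewise_constant P g /\
   ((ae_in C (ceiling F (cst (b + H))) /\ ae_in S (ceiling F g)) \/
    exists J : set R,
      [/\ is_interval J, (0 < lebesgue_measure J)%E,
          ae_in C [set p | J (wproj1 p)] &
          nowhere_strictly_log_convex f J])).
Proof.
move=> hN f0 fs fl _ k0 Fb PS Pfin bg dg H0 rooms S C.
pose c := b + H.
have bc : b <= c by rewrite lerDl.
have [u1 [u2 [lnfP u1P cu2 fP]]] := smooth_ln f0 fs.
have cu1 : continuous u1 by move=> t; exact: is_derive_continuous (u1P t).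
have u1_le := convex_derive_le fl cu1 lnfP.
have cf : continuous f by move=> t; exact: is_derive_continuous (fP t).
have cfk : continuous (fun t => f t ^+ k).
  rewrite -exprfctE; elim: (k) => [|j IH]; first by rewrite expr0 => t; exact: cst_continuous.
  by rewrite exprS => t; apply: continuousM; [exact: cf|exact: IH].
have [V [Vb VP VE]] := continuous_antiderivative b cfk.
have PF i x : pdom P i x -> F (Defs.pmap P i x).
  by move=> Dx; apply: (patch_sub PS); exists i => //; exists x.
pose h i := along P g i; pose psi i x : N := wproj2 (Defs.pmap P i x).
have fiber_i i x : pdom P i x -> wproj1 (Defs.pmap P i x) = b by move=> /PF/Fb.
have bh i x : pdom P i x -> b <= h i x by move=> /PF/bg.
(* One Borel null set per patch absorbs all points where the height is not differentiable; the
   comparison runs on the complements [D i]. *)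
have [A hA] : {A : nat -> set 'rV[R]_k & forall i, [/\ measurable (A i),
    lebesgue_rV R k (A i) = 0%E &
    forall x, (pdom P i `\` A i) x -> differentiable (h i) x]}.
  apply: (@choice _ _ (fun i A => [/\ measurable A, lebesgue_rV R k A = 0%E &
    forall x, (pdom P i `\` A) x -> differentiable (h i) x])) => i.
  have [A [mA A0 sA]] := dg i; exists A; split; [exact: mA|exact: A0|move=> x [Dx nAx]].
  by apply: contrapT => nd; apply: nAx; apply: sA => /= dd; exact/nd/dd.
have mA i : measurable (A i) by case: (hA i).
have A0 i : lebesgue_rV R k (A i) = 0%E by case: (hA i).
have dh i x : (pdom P i `\` A i) x -> differentiable (h i) x by case: (hA i) => _ _; apply.
pose D i := pdom P i `\` A i.
have DP i x : D i x -> pdom P i x by case.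
pose rho i := density (Defs.pmap P i).
pose cd i := ceiling_density (Defs.pmap P i) (h i).
have oD i : open (pdom P i) by case: PS.
have sD i : smooth_map (pdom P i) (Defs.pmap P i) by case: PS.
have iD i x : pdom P i x -> row_free (mdiff (Defs.pmap P i) x).
  by case: PS => _ _ + _ _ _; apply.
have mD i : measurable (D i) by exact: measurable_patchD (oD i) _ (mA i).
have rho_gt0 i x : pdom P i x -> 0 < rho i x.
  exact: (density_gt0 hN (oD i) (sD i) (fiber_i i) (iD i)).
have arho : admissible D rho.
  move=> i; split; first exact: (measurable_density hN (oD i) (sD i) (mA i)).
  by move=> x /DP /rho_gt0/ltW.
have acd : admissible D cd.
  move=> i; split; last by move=> x _; exact: sqrtr_ge0.
  exact: (measurable_ceiling_density hN cf (oD i) (sD i) (mA i) (dh i)).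
have cd_ge i x : D i x -> rho i x * f (h i x) ^+ k <= cd i x.
  move=> /DP; exact: (ceiling_density_ge hN f0 (oD i) (sD i) (fiber_i i) (iD i)).
have mh i : measurable_fun (D i) (h i : _ -> measurableTypeR R).
  apply: measurable_fun_continuous => // x /dh; exact: differentiable_continuous.
have dc i x : (pdom P i `\` A i) x -> differentiable (cst c : 'rV[R]_k -> R) x by [].
have fc0 : 0 < f c ^+ k by rewrite exprn_gt0.
pose tot := sumint (lebesgue_rV R k) D.
have volC : volume C = tot cd.
  apply: eq_eseriesr => i _.
  exact: (param_volume_ceiling hN (sD i) (mA i) (A0 i) (dh i)).
have totZ a : 0 <= a -> tot (fun i x => a * rho i x) = (a%:E * tot rho)%E.
  by move=> a0; exact: sumintZ.
have volS : volume S = ((f c ^+ k)%:E * tot rho)%E.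
  apply: etrans (totZ _ (ltW fc0)).
  apply: eq_eseriesr => i _.
  apply: etrans (param_volume_ceiling hN (sD i) (mA i) (A0 i) (dc i)) _.
  apply: eq_integral => x; rewrite inE => /DP Dx; congr EFin.
  apply/esym; rewrite mulrC.
  apply/(ceiling_density_eq hN f0 (oD i) (sD i) (fiber_i i) (iD i) (cst c) Dx).
  by move=> v; rewrite diff_cst.
(* The floor has volume [f b ^+ k] times [tot rho], and the factor is positive. *)
have rho_fin : (tot rho < +oo)%E.
  have fb0 : 0 < f b ^+ k by rewrite exprn_gt0.
  have volP : volume P = ((f b ^+ k)%:E * tot rho)%E.
    apply: etrans (totZ _ (ltW fb0)).
    apply: eq_eseriesr => i _.
    exact: (param_volume_floor hN f0 (oD i) (sD i) (fiber_i i) (iD i) (mA i) (A0 i)).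
  rewrite ltNge leye_eq; apply/negP => /eqP e.
  by move: Pfin; rewrite volP e gt0_muley ?lte_fin// ltxx.
have rooms' : tot (fun i x => rho i x * V (h i x)) = tot (fun i x => rho i x * V c).
  have eg : volume (room_patches P b g) = tot (fun i x => rho i x * V (h i x)).
    apply: eq_eseriesr => i _.
    exact: (param_volume_room hN f0 cf (oD i) (sD i) (fiber_i i) (iD i) (mA i)
      (A0 i) (dh i) (bh i) VE).
  have ec : volume (room_patches P b (cst c)) = tot (fun i x => rho i x * V c).
    apply: eq_eseriesr => i _.
    exact: (param_volume_room hN f0 cf (oD i) (sD i) (fiber_i i) (iD i) (mA i)
      (A0 i) (dc i) (fun _ _ => bc) VE).
  exact: (etrans (esym eg) (etrans (esym rooms) ec)).
have rho_gt0' i x : D i x -> 0 < rho i x by move/DP; exact: rho_gt0.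
have bh' i x : D i x -> b <= h i x by move/DP; exact: bh.
have toD i Q : {ae lebesgue_rV R k, forall x, D i x -> Q x} ->
    {ae lebesgue_rV R k, forall x, pdom P i x -> Q x}.
  exact: (ae_setD (mA i) (A0 i)).
have fromD i Q : {ae lebesgue_rV R k, forall x, pdom P i x -> Q x} ->
    {ae lebesgue_rV R k, forall x, D i x -> Q x}.
  by move=> HQ; apply: filterS HQ => x Hx Dx; exact: Hx (DP _ _ Dx).
pose e := calib f u1 k c V.
have mainE := sumint_constant_eq mD arho
  rho_gt0' mh bh' acd cd_ge f0 fP u1_le bc VP Vb rho_fin rooms'.
split.
  rewrite volS volC.
  exact: (sumint_constant_le mD arho mh bh' acd cd_ge f0 fP
    u1_le bc VP Vb rho_fin rooms').
rewrite volS volC; split.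
  move=> /mainE eq.
  have grad0 i : {ae lebesgue_rV R k, forall x, pdom P i x -> forall v, 'd (h i) x v = 0}.
    apply: toD; apply: filterS (eq i) => x Hx Dx.
    apply/(ceiling_density_eq hN f0 (oD i) (sD i) (fiber_i i) (iD i) (h i) (DP _ _ Dx)).
    by case: (Hx Dx).
  split.
    split; first exact: grad0.
    move=> i U oU UD; exact: (ae_diff0_locally_constant (grad0 i) oU UD).
  have he i : {ae lebesgue_rV R k, forall x, pdom P i x -> e (h i x) = 0}.
    by apply: toD; apply: filterS (eq i) => x Hx /Hx[].
  (* Either the height is [c] almost everywhere, and then [C] and [S] agree up to measure zero, or
     some point has a height other than [c] at which [e] vanishes. *)
  have [hc|/existsNP[i nhc]] :=
      pselect (forall i, {ae lebesgue_rV R k, forall x, pdom P i x -> h i x = c}).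
    left; split=> i; apply: filterS (hc i) => x hx Dx; exists (Defs.pmap P i x); try exact: PF.
      exact: (congr1 (fun t => wpair f t (psi i x)) (esym (hx Dx))).
    exact: (congr1 (fun t => wpair f t (psi i x)) (hx Dx)).
  right; have [x [Dx ex nx]] : exists x, [/\ pdom P i x, e (h i x) = 0 & h i x <> c].
    apply: contrapT => nex; apply: nhc; apply: filterS (he i) => x ex Dx.
    by apply: contrapT => nx; apply: nex; exists x; split; [exact: Dx|exact: ex|exact: nx].
  (* This interval contains both [c] and the exceptional height, hence a nondegenerate segment, so
     its measure is positive. *)
  pose J := [set t | b <= t /\ e t = 0].
  have iJ : is_interval J := calib0_interval f0 fP u1_le bc VP.
  exists J; split; first exact: iJ.
  - have Jx : J (h i x) by split; [exact: bh|exact: ex].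
    have Jc : J c by split; [exact: bc|exact: calib_c].
    have mJ : measurable J by exact: is_interval_measurable.
    have pos s t : J s -> J t -> s < t -> (0 < lebesgue_measure J)%E.
      move=> Js Jt st; apply: (@lt_le_trans _ _ (lebesgue_measure `[s, t])).
        by rewrite lebesgue_measure_itv/= lte_fin st -EFinB lte_fin subr_gt0.
      apply: le_measure; [by rewrite inE; exact: measurable_itv|by rewrite inE|].
      by move=> z /=; rewrite in_itv/=; exact: iJ.
    case: (ltgtP (h i x) c) => [lt|lt|/nx[]]; [exact: (pos _ _ Jx Jc)|exact: (pos _ _ Jc Jx)].
  - by move=> j; apply: filterS (he j) => y Hy Dy; split; [exact: bh|exact: Hy].
  - exact: (calib0_nowhere f0 lnfP fP).
move=> [[grad0 _] cases]; apply/mainE => i.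
(* The vanishing differential already settles the tilt; only the calibration is left. *)
suff he : {ae lebesgue_rV R k, forall x, pdom P i x -> e (h i x) = 0}.
  have g0 := grad0 i; apply: filterS2 g0 he => x g0 ex Dx; split; last exact: ex (DP _ _ Dx).
  apply/(ceiling_density_eq hN f0 (oD i) (sD i) (fiber_i i) (iD i) (h i) (DP _ _ Dx)).
  exact: g0 (DP _ _ Dx).
case: cases => [[hC _]|[J [iJ _ hJ nJ]]].
  apply: filterS (hC i) => x Hx Dx; have [p _ ep] := Hx Dx.
  have hxc : h i x = c := esym (congr1 (fun w : warped_product f N => wproj1 w) ep).
  by rewrite hxc; exact: calib_c.
(* If [J] misses [c], then, being an interval, it lies entirely on one side of [c], and the equality
   of the rooms forces the height to be [c] after all. *)
have [Jc|nJc] := pselect (J c).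
  apply: filterS (hJ i) => x Jx Dx.
  exact: (calib_eq0 lnfP u1P cu2 fP u1_le bc VP iJ nJ Jc (Jx Dx) (bh _ _ Dx)).
have one := constant_of_one_sided mD arho rho_gt0' mh bh' f0 bc VP Vb rho_fin rooms'.
have hc : {ae lebesgue_rV R k, forall x, pdom P i x -> h i x = c}.
  apply: toD; apply: one.
  have [[s Js sc]|nlt] := pselect (exists2 s, J s & s < c).
    right=> j; apply: fromD; apply: filterS (hJ j) => x Jx Dx.
    have [//|ct] := leP (h j x) c; case: nJc.
    exact: (iJ s (h j x) Js (Jx Dx) c (introT andP (conj (ltW sc) (ltW ct)))).
  left=> j; apply: fromD; apply: filterS (hJ j) => x Jx Dx.
  have [//|tc] := leP c (h j x); case: nlt.
  by exists (h j x); [exact: Jx|exact: tc].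
apply: filterS hc => x Hx Dx.
exact: (etrans (congr1 e (Hx Dx)) (calib_c _ _ _ _ _)).
Qed.
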